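(* Let $A=\{1,\dots,|A|\}$ be a finite set, $n\ge 1$, $R\subseteq A^{2n+1}$, and suppose there exists a $\mathbf z$-parameterized nonempty 1-consistent reduction for $\mathcal I_R$. Then at least one of the following conditions holds: (1) $\mathcal I_R$ has a solution for every $\mathbf z\in A^{|A|}$; (2) there exists a mighty tuple IV or a mighty tuple V q-definable from $R$.
   Context: q-definability: a relation $P\subseteq A^r$ is q-definable from $R$ if it is defined by a formula with free variables among $v_1,\dots,v_r$ consisting of a prefix of quantifiers $\forall,\exists$ over $A$ followed by a finite, possibly empty, conjunction of atoms over $R$. A tuple of relations is q-definable if each member is. The instance $\mathcal I_R$: write $R(y_0,\dots,y_n,x_1,\dots,x_n)$. For $0\le m\le n-1$ put $$\mathcal S_R^{m}(y_0,\dots,y_m,x_1,\dots,x_m)=\forall x\,\exists y_{m+1}\forall x'\,\exists y_{m+2}\dots\exists y_{n}\;R(y_0,\dots,y_n,x_1,\dots,x_m,x,x',\dots,x'),$$ and $\mathcal S_R^{n}=R$. $\mathcal I_R$ is the CSP instance with variables $y_m^{a_1,\dots,a_m}$ ($0\le m\le n$, $a_1,\dots,a_m\in A$; for $m=0$ the single variable $y_0$), external parameters $\mathbf z=(z_1,\dots,z_{|A|})\in A^{|A|}$, and one constraint $\mathcal S_R^m(y_0,y_1^{a_1},\dots,y_m^{a_1,\dots,a_m},z_{a_1},\dots,z_{a_m})$ for each $m\in\{0,\dots,n\}$ and $a_1,\dots,a_m\in A$. For each fixed $\mathbf z$ it is an ordinary CSP instance over $A$. Reductions: a $\mathbf z$-parameterized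 unary relation is a subset $U\subseteq A^{|A|+1}$, with ${}^{\mathbf z}U=\{a:(\mathbf z,a)\in U\}$; it is nonempty if ${}^{\mathbf z}U\neq\varnothing$ for every $\mathbf z$. A $\mathbf z$-parameterized reduction $D^{(\top)}$ assigns a $\mathbf z$-parameterized unary relation $D_u^{(\top)}$ to each variable $u$ of $\mathcal I_R$. It is nonempty if ${}^{\mathbf z}D_u^{(\top)}\ne\varnothing$ for all $u,\mathbf z$. It is 1-consistent if for every $\mathbf z$, every constraint on variables $u_1,\dots,u_s$ with constraint relation ${}^{\mathbf z}P\subseteq A^s$, and every $i$, the projection of ${}^{\mathbf z}P\cap({}^{\mathbf z}D_{u_1}^{(\top)}\times\dots\times{}^{\mathbf z}D_{u_s}^{(\top)})$ onto the $i$-th coordinate equals ${}^{\mathbf z}D_{u_i}^{(\top)}$. Notation: a $(\mathbf z,\alpha)$-parameterized binary relation is $Q\subseteq A^{|A|+m+2}$ with $m\ge1$; ${}^{\mathbf z}Q^{\alpha}=\{(a,b):(\mathbf z,\alpha,a,b)\in Q\}$ for $\alpha\in A^m$; ${}^{\mathbf z}Q^{\forall}=\bigcap_{x\in A}{}^{\mathbf z}Q^{x,\dots,x}$, ${}^{\mathbf z}Q^{\forall\forall}=\bigcap_{\alpha\in A^m}{}^{\mathbf z}Q^{\alpha}$. For unary $U$ and binary $S$: $U+S=\{y:\exists x\,(U(x)\wedge S(x,y))\}$. $\mathrm{pr}_i$ is projection onto the $i$-th coordinate. Mighty tuple IV: a tuple $(Q,D,B,C)$, with $Q$ a $(\mathbf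 z,\alpha)$-parameterized binary relation and $D,B,C$ $\mathbf z$-parameterized unary relations, such that: 1. $\varnothing\ne{}^{\mathbf z}B\subseteq{}^{\mathbf z}D$ and $\varnothing\ne{}^{\mathbf z}C\subseteq{}^{\mathbf z}D$ for every $\mathbf z$; 2. ${}^{\mathbf z}B+{}^{\mathbf z}Q^{\forall\forall}={}^{\mathbf z}B$ for every $\mathbf z$; 3. ${}^{\mathbf z}B+{}^{\mathbf z}Q^{\forall}={}^{\mathbf z}D$ for every $\mathbf z$; 4. ${}^{\mathbf z}D+{}^{\mathbf z}Q^{\forall\forall}={}^{\mathbf z}D$ for every $\mathbf z$; 5. ${}^{\mathbf z}B\cap{}^{\mathbf z}C=\varnothing$ for some $\mathbf z\in A^{|A|}$. Mighty tuple V: a tuple $(Q,D)$, with $Q$ a $(\mathbf z,\alpha)$-parameterized binary relation and $D$ a nonempty $\mathbf z$-parameterized unary relation, such that: 1. $\{(d,d)\mid d\in{}^{\mathbf z}D\}\subseteq{}^{\mathbf z}Q^{\forall}$ for every $\mathbf z$; 2. $\mathrm{pr}_1({}^{\mathbf z}Q^{\forall\forall})=\mathrm{pr}_2({}^{\mathbf z}Q^{\forall\forall})={}^{\mathbf z}D$ for every $\mathbf z$; 3. ${}^{\mathbf z}Q^{\forall\forall}\cap\{(d,d)\mid d\in A\}=\varnothing$ for some $\mathbf z\in A^{|A|}$. *)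

(* Defs.v *)
From mathcomp Require Import all_boot.

Set Implicit Arguments.
Unset Strict Implicit.
Unset Printing Implicit Defensive.

Section QDefinability.

Variable A : finType.

(* Prenex formulas over one N-ary relation symbol: the type [qformula N r] is
   that of formulas whose free variables are among the first r, and each
   quantifier binds the next variable (number r).  Equality is not an atom, and
   the conjunction may be empty. *)
Inductive qformula (N r : nat) : Type :=
| QConj of seq (N.-tuple 'I_r)
| QForall of qformula N r.+1
| QExists of qformula N r.+1.

Fixpoint qsat (N r : nat) (R : {set N.-tuple A}) (phi : qformula N r) :
    r.-tuple A -> bool :=
  match phi with
  | QConj atoms => fun e =>
      all (fun at_ : N.-tuple 'I_r => [tuple of map (tnth e) at_] \in R) atoms
  | QForall psi => fun e => [forall x, qsat R psi [tuple of rcons e x]]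
  | QExists psi => fun e => [exists x, qsat R psi [tuple of rcons e x]]
  end.

Definition qdefinable (N r : nat) (R : {set N.-tuple A})
    (P : {set r.-tuple A}) : Prop :=
  exists phi : qformula N r, P = [set e | qsat R phi e].

End QDefinability.

Section CSP.

Variables (V : Type) (A : finType).

Record constraint : Type := Constraint {
  arity : nat;
  scope : arity.-tuple V;
  crel : {set arity.-tuple A}
}.

(* A CSP instance is a family of constraints. *)
Definition is_solution (I : Type) (P : I -> constraint) (s : V -> A) : Prop :=
  forall c, [tuple of map s (scope (P c))] \in crel (P c).

Definition one_consistent (I : Type) (P : I -> constraint)
    (D : V -> {set A}) : Prop :=
  forall c (i : 'I_(arity (P c))),
    [set tnth t i | t in crel (P c) :&:
      [set t : (arity (P c)).-tuple A |
        [forall j, tnth t j \in D (tnth (scope (P c)) j)]]]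
    = D (tnth (scope (P c)) i).

End CSP.

(* The domain {1, ..., k} is represented by 'I_k, so that z_a is [tnth z a] for
   an element a and external parameters z : k.-tuple 'I_k. *)
Section InstanceR.

Variables (k n : nat) (R : {set (n.+1 + n).-tuple 'I_k}).

Notation A := 'I_k.

Definition Rholds (s : seq A) : bool := [exists t in R, val t == s].

(* S_R^m(y_0, .., y_m, x_1, .., x_m), meant for m <= n; when m = n.-1 the
   sequence ys is empty and the quantifier on x' is vacuous. *)
Definition S_R (m : nat) (y : m.+1.-tuple A) (xs : m.-tuple A) : bool :=
  if m == n then Rholds (y ++ xs)
  else [forall x, exists y1, forall x', exists ys : (n - m.+1).-tuple A,
          Rholds ((y ++ y1 :: ys) ++ (xs ++ x :: nseq (n - m.+1) x'))].

(* The word a_1 .. a_m, of length m <= n, stands for the variable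
   y_m^{a_1, .., a_m}; words also index the constraints of the instance. *)
Definition word : Type := n.-bseq A.

Lemma size_take_word (i : nat) (a : word) : size (take i a) <= n.
Proof. by rewrite (leq_trans _ (size_bseq a)) // size_take_min geq_minr. Qed.

Definition prefix_word (i : nat) (a : word) : word := Bseq (size_take_word i a).

Definition I_R (z : k.-tuple A) (a : word) : constraint word A :=
  Constraint
    [tuple prefix_word i a | i < (size a).+1]
    [set b : (size a).+1.-tuple A |
      S_R b [tuple of map (tnth z) (in_tuple a)]].

End InstanceR.

Section Parameterized.

Variable k : nat.

Notation A := 'I_k.

Definition punary : Type := {set (k + 1).-tuple A}.

Definition usection (U : punary) (z : k.-tuple A) : {set A} :=
  [set a | [tuple of z ++ [:: a]] \in U].

Definition nonempty_punary (U : punary) : Prop :=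
  forall z, usection U z != set0.

Definition nonempty_reduction (n : nat) (D : word k n -> punary) : Prop :=
  forall u, nonempty_punary (D u).

Definition one_consistent_reduction (n : nat) (R : {set (n.+1 + n).-tuple A})
    (D : word k n -> punary) : Prop :=
  forall z, one_consistent (I_R R z) (fun u => usection (D u) z).

Definition pbinary (m : nat) : Type := {set (k + m + 2).-tuple A}.

Definition bsection (m : nat) (Q : pbinary m) (z : k.-tuple A)
    (alpha : m.-tuple A) : {set A * A} :=
  [set p | [tuple of (z ++ alpha) ++ [:: p.1; p.2]] \in Q].

Definition bsection_diag (m : nat) (Q : pbinary m) (z : k.-tuple A) : {set A * A} :=
  \bigcap_(x : A) bsection Q z (nseq_tuple m x).

Definition bsection_all (m : nat) (Q : pbinary m) (z : k.-tuple A) : {set A * A} :=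
  \bigcap_(alpha : m.-tuple A) bsection Q z alpha.

Definition uplus (U : {set A}) (S : {set A * A}) : {set A} :=
  [set y | [exists x, (x \in U) && ((x, y) \in S)]].

Definition mightyIV (m : nat) (Q : pbinary m) (D B C : punary) : Prop :=
  [/\ forall z, [/\ usection B z != set0, usection B z \subset usection D z,
                    usection C z != set0 & usection C z \subset usection D z],
      forall z, uplus (usection B z) (bsection_all Q z) = usection B z,
      forall z, uplus (usection B z) (bsection_diag Q z) = usection D z,
      forall z, uplus (usection D z) (bsection_all Q z) = usection D z &
      exists z, usection B z :&: usection C z = set0].

Definition mightyV (m : nat) (Q : pbinary m) (D : punary) : Prop :=
  [/\ nonempty_punary D,
      forall z, [set (d, d) | d in usection D z] \subset bsection_diag Q z,
      forall z, [set p.1 | p in bsection_all Q z] = usection D z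
                /\ [set p.2 | p in bsection_all Q z] = usection D z &
      exists z, bsection_all Q z :&: [set (d, d) | d : A] = set0].

End Parameterized.

(* Main.v *)
(* Let T^m be the relation "the existential player wins the game for R from
   (y_0, .., y_m, x_1, .., x_m)"; condition (1) says that T^0 is nonempty. Starting
   from T^n = R, the instance in which the constraints S^m of depth m are replaced
   by T^m is shown to stay 1-consistent when m decreases; for m = 0 this gives T^0.

   In the step from m+1 to m, S^m has to be intersected with the relations
   G_a = (exists y_(m+1), T^(m+1)), the universal move being z_a. If 1-consistency
   were lost, a finite tree of such constraints would have no solution. View the
   vertices of this tree as variables of a new instance, with constraints S^m and
   G_a. Restrict the later universal moves in G_a to the image of a map alpha: for
   alpha = id this is G_a, and for constant alpha the relation contains S^m. Thus
   every relation definable between two copies of the same variable is reflexive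
   for constant alpha, and without mighty tuples V it has a loop for alpha = id as
   soon as it is subdirect there.

   Let D be a minimal definable 1-consistent reduction of the new instance, and V
   one of its domains. If a definable X were a proper subset of V, then some tree
   formula over the instance would have no solution with all its copies of the
   variable of V in X. Mighty tuples IV bound the number of connected steps after
   which a restriction such as X can still be felt, so taking X as far as possible
   from its origin makes the copies independent. In this way any two copies of a
   variable in a tree formula can be identified, so V has no proper definable
   subset. With all the domains of this kind, mighty tuples V allow to identify all
   copies of every variable, and the new instance is solvable: a contradiction. *)

Require Import Defs.
From mathcomp Require Import all_boot.
From mathcomp Require Import boolp.

Set Implicit Arguments.
Unset Strict Implicit.
Unset Printing Implicit Defensive.

(** * Definable relations *)

Section Definability.

Variables (A : finType) (N : nat) (R : {set N.-tuple A}).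

(** A semantic counterpart of [qdefinable]: free variables are indexed by any finite type, so that
    renaming is composition, and a bound variable is the index [None]. Prenex form is restored in
    [qdef_prenex]. *)
Inductive qdef : forall I : finType, ((I -> A) -> Prop) -> Prop :=
| qdef_true (I : finType) : @qdef I (fun _ => True)
| qdef_atom (I : finType) (s : 'I_N -> I) :
    @qdef I (fun e => [tuple e (s i) | i < N] \in R)
| qdef_and (I : finType) (P Q : (I -> A) -> Prop) :
    qdef P -> qdef Q -> qdef (fun e => P e /\ Q e)
| qdef_ex (I : finType) (P : (I -> A) -> A -> Prop) :
    @qdef (option I) (fun e => P (fun i => e (Some i)) (e None)) ->
    qdef (fun e => exists x, P e x)
| qdef_all (I : finType) (P : (I -> A) -> A -> Prop) :
    @qdef (option I) (fun e => P (fun i => e (Some i)) (e None)) ->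
    qdef (fun e => forall x, P e x).

Lemma qdef_iff (I : finType) (P Q : (I -> A) -> Prop) :
  (forall e, P e <-> Q e) -> qdef P -> qdef Q.
Proof. by move=> PQ; have -> : P = Q by apply/funext => e; apply/propext. Qed.

Lemma qdef_sub (I : finType) (P : (I -> A) -> Prop) (J : finType) (g : I -> J) :
  qdef P -> qdef (fun e : J -> A => P (fun i => e (g i))).
Proof.
move=> qP; elim: qP J g => {I P}.
- by move=> *; exact: qdef_true.
- by move=> I s J g; exact: (qdef_atom (g \o s)).
- by move=> I P Q _ IP _ IQ J g; apply: qdef_and; [apply: IP|apply: IQ].
- by move=> I P _ IP J g; apply: qdef_ex; apply: (IP _ (omap g)).
- by move=> I P _ IP J g; apply: qdef_all; apply: (IP _ (omap g)).
Qed.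

Definition env_cat (I K : Type) (e : I -> A) (b : K -> A) (x : I + K) : A :=
  match x with inl i => e i | inr w => b w end.

Lemma qdef_ex_ord (I : finType) (m : nat) (P : (I -> A) -> ('I_m -> A) -> Prop) :
  @qdef (I + 'I_m)%type (fun e => P (fun i => e (inl i)) (fun j => e (inr j))) ->
  qdef (fun e => exists b, P e b).
Proof.
elim: m I P => [|m IH] I P qP.
  pose g (x : I + 'I_0) : I :=
    match x with inl i => i | inr j => False_rect I (notF (ltn_ord j)) end.
  apply: qdef_iff (qdef_sub g qP) => e; split=> [Pe|[b]]; first by eexists; exact: Pe.
  by congr (P _ _) => //; apply/funext => -[].
pose B (e : I -> A) (x : A) (b : 'I_m -> A) :=
  P e (fun j => if unlift ord0 j is Some j' then b j' else x).
suff: qdef (fun e => exists x, exists b, B e x b).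
  apply: qdef_iff => e; split=> [[x [b Pb]]|[b Pb]]; first by eexists; exact: Pb.
  exists (b ord0), (fun j => b (lift ord0 j)); congr (P _ _) : Pb.
  by apply/funext => j; case: unliftP => [j' ->|->].
apply: qdef_ex.
apply: (IH _ (fun e b => B (fun i => e (Some i)) (e None) b)).
pose g (x : I + 'I_m.+1) : option I + 'I_m :=
  match x with
  | inl i => inl (Some i)
  | inr j => if unlift ord0 j is Some j' then inr j' else inl None
  end.
apply: qdef_iff (qdef_sub g qP) => e; rewrite /B /g.
by rewrite (_ : (fun j => _) = (fun j =>
    if unlift ord0 j is Some j' then e (inr j') else e (inl None))) //;
  apply/funext => j; case: unlift.
Qed.

Lemma qdef_ex_fin (I W : finType) (P : (I -> A) -> (W -> A) -> Prop) :
  @qdef (I + W)%type (fun e => P (fun i => e (inl i)) (fun j => e (inr j))) ->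
  qdef (fun e => exists b, P e b).
Proof.
move=> qP.
suff: qdef (fun e => exists b : 'I_#|W| -> A, P e (fun w => b (enum_rank w))).
  apply: qdef_iff => e; split=> [[b Pb]|[b Pb]]; first by eexists; exact: Pb.
  exists (fun i => b (enum_val i)); congr (P _ _) : Pb.
  by apply/funext => w; rewrite enum_rankK.
apply: (qdef_ex_ord (P := fun e b => P e (fun w => b (enum_rank w)))).
pose g (x : I + W) : I + 'I_#|W| :=
  match x with inl i => inl i | inr w => inr (enum_rank w) end.
exact: (qdef_sub g qP).
Qed.

Lemma qdef_forall_fin (I W : finType) (P : W -> (I -> A) -> Prop) :
  (forall w, qdef (P w)) -> qdef (fun e => forall w, P w e).
Proof.
move=> qP; suff: forall s : seq W, qdef (fun e => forall w, w \in s -> P w e).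
  move=> /(_ (enum W)); apply: qdef_iff => e; split=> h w; last by move=> _.
  by apply: h; rewrite mem_enum.
elim=> [|w s IH]; first by apply: qdef_iff (qdef_true I).
apply: qdef_iff (qdef_and (qP w) IH) => e; split=> [[Pw Ps] u|h].
  by rewrite inE => /predU1P [->|/Ps].
by split=> [|u us]; apply: h; rewrite inE ?eqxx // us orbT.
Qed.

Hypothesis a0 : A.

Lemma tnth_rcons_lift (r : nat) (e : r.-tuple A) x (i : 'I_r) :
  tnth [tuple of rcons e x] (lift ord_max i) = tnth e i.
Proof. by rewrite !(tnth_nth x) lift_max /= nth_rcons size_tuple ltn_ord. Qed.

Lemma tnth_rcons_max (r : nat) (e : r.-tuple A) x :
  tnth [tuple of rcons e x] ord_max = x.
Proof. by rewrite (tnth_nth x) /= nth_rcons size_tuple ltnn eqxx. Qed.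

Lemma qformula_rename (r : nat) (psi : qformula N r) (r' : nat) (f : 'I_r -> 'I_r') :
  exists psi' : qformula N r', forall e : r'.-tuple A,
    qsat R psi' e = qsat R psi [tuple tnth e (f i) | i < r].
Proof.
elim: psi r' f => {r} [r atoms|r psi IH|r psi IH] r' f.
- exists (QConj [seq [tuple f (tnth at_ i) | i < N] | at_ : N.-tuple 'I_r <- atoms]) => e /=.
  rewrite all_map; apply: eq_all => at_ /=; congr (_ \in R).
  by apply: eq_from_tnth => i; rewrite !tnth_map !tnth_ord_tuple.
- pose g (i : 'I_r.+1) : 'I_r'.+1 := oapp (lift ord_max \o f) ord_max (unlift ord_max i).
  have [psi' Hpsi] := IH r'.+1 g; exists (QForall psi') => e /=.
  apply: eq_forallb => x; rewrite Hpsi; congr (qsat R psi _).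
  apply: eq_from_tnth => i; rewrite tnth_map tnth_ord_tuple /g.
  case: (unliftP ord_max i) => [j ->|->] /=.
    by rewrite !tnth_rcons_lift tnth_map tnth_ord_tuple.
  by rewrite !tnth_rcons_max.
- pose g (i : 'I_r.+1) : 'I_r'.+1 := oapp (lift ord_max \o f) ord_max (unlift ord_max i).
  have [psi' Hpsi] := IH r'.+1 g; exists (QExists psi') => e /=.
  apply: eq_existsb => x; rewrite Hpsi; congr (qsat R psi _).
  apply: eq_from_tnth => i; rewrite tnth_map tnth_ord_tuple /g.
  case: (unliftP ord_max i) => [j ->|->] /=.
    by rewrite !tnth_rcons_lift tnth_map tnth_ord_tuple.
  by rewrite !tnth_rcons_max.
Qed.

Lemma qformula_weaken (r : nat) (psi : qformula N r) :
  exists psi' : qformula N r.+1, forall (e : r.-tuple A) x,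
    qsat R psi' [tuple of rcons e x] = qsat R psi e.
Proof.
have [psi' Hpsi] := qformula_rename psi (lift ord_max); exists psi' => e x.
rewrite Hpsi; congr (qsat R psi _); apply: eq_from_tnth => i.
by rewrite tnth_map tnth_ord_tuple tnth_rcons_lift.
Qed.

(** Moving a conjunct out of a universal quantifier needs a nonempty domain: over an empty one the
    left side is true even for [b = false]. *)
Lemma forall_andr (P : pred A) (b : bool) :
  [forall x, P x && b] = [forall x, P x] && b.
Proof.
apply/forallP/andP => [h|[/forallP h hb] x]; last by rewrite h hb.
split; last by have /andP [] := h a0.
by apply/forallP => x; have /andP [] := h x.
Qed.

Lemma exists_andr (P : pred A) (b : bool) :
  [exists x, P x && b] = [exists x, P x] && b.
Proof.
apply/existsP/andP => [[x /andP [Px hb]]|[/existsP [x Px] hb]].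
  by split=> //; apply/existsP; exists x.
by exists x; rewrite Px hb.
Qed.

(** The quantifiers of [phi] are pulled out first, then those of [psi], the other formula being
    weakened past each binder; at the bottom two lists of atoms are concatenated. *)
Lemma qformula_and (r : nat) (phi psi : qformula N r) :
  exists chi : qformula N r, forall e, qsat R chi e = qsat R phi e && qsat R psi e.
Proof.
have atomic r' (at1 : seq (N.-tuple 'I_r')) (psi' : qformula N r') :
    exists chi : qformula N r', forall e,
      qsat R chi e = qsat R psi' e && qsat R (QConj at1) e.
  elim: psi' at1 => {}r' => [at2|psi' IH|psi' IH] at1.
  - by exists (QConj (at2 ++ at1)) => e /=; rewrite all_cat.
  - have [at1' H1] := qformula_weaken (QConj at1).
    pose up (at_ : N.-tuple 'I_r') := [tuple lift ord_max (tnth at_ i) | i < N].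
    have [chi Hchi] := IH (map up at1); exists (QForall chi) => e.
    rewrite /= -forall_andr; apply: eq_forallb => x; rewrite Hchi; congr (_ && _).
    rewrite /= all_map; apply: eq_all => at_ /=; congr (_ \in R).
    by apply: eq_from_tnth => i; rewrite !tnth_map tnth_ord_tuple tnth_rcons_lift.
  - pose up (at_ : N.-tuple 'I_r') := [tuple lift ord_max (tnth at_ i) | i < N].
    have [chi Hchi] := IH (map up at1); exists (QExists chi) => e.
    rewrite /= -exists_andr; apply: eq_existsb => x; rewrite Hchi; congr (_ && _).
    rewrite /= all_map; apply: eq_all => at_ /=; congr (_ \in R).
    by apply: eq_from_tnth => i; rewrite !tnth_map tnth_ord_tuple tnth_rcons_lift.
elim: phi psi => {r} r => [at1|phi IH|phi IH] psi.
- by have [chi Hchi] := atomic r at1 psi; exists chi => e; rewrite Hchi andbC.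
- have [psi' Hpsi] := qformula_weaken psi; have [chi Hchi] := IH psi'.
  by exists (QForall chi) => e /=; rewrite -forall_andr; apply: eq_forallb => x;
    rewrite Hchi Hpsi.
- have [psi' Hpsi] := qformula_weaken psi; have [chi Hchi] := IH psi'.
  by exists (QExists chi) => e /=; rewrite -exists_andr; apply: eq_existsb => x;
    rewrite Hchi Hpsi.
Qed.

Lemma qdef_prenex (I : finType) (P : (I -> A) -> Prop) (r : nat) (g : I -> 'I_r) :
  qdef P -> exists phi : qformula N r, forall e : r.-tuple A,
    qsat R phi e <-> P (fun i => tnth e (g i)).
Proof.
move=> qP; elim: qP r g => {I P}.
- by move=> I r g; exists (QConj [::]).
- move=> I s r g; exists (QConj [:: [tuple g (s i) | i < N]]) => e /=.
  rewrite andbT; suff -> : [tuple of map (tnth e) [tuple g (s i) | i < N]]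
    = [tuple tnth e (g (s i)) | i < N] by [].
  by apply: eq_from_tnth => i; rewrite !tnth_map.
- move=> I P Q _ IP _ IQ r g.
  have [phi Hphi] := IP r g; have [psi Hpsi] := IQ r g.
  have [chi Hchi] := qformula_and phi psi; exists chi => e; rewrite Hchi.
  split=> [/andP [/Hphi ? /Hpsi ?] //|[/Hphi h1 /Hpsi h2]]; exact/andP.
- move=> I P _ IP r g.
  have [phi Hphi] := IP r.+1 (oapp (lift ord_max \o g) ord_max).
  have Hx (e : r.-tuple A) x : qsat R phi [tuple of rcons e x] <-> P (fun i => tnth e (g i)) x.
    rewrite Hphi /= tnth_rcons_max (_ : (fun i => _) = (fun i => tnth e (g i))) //.
    by apply/funext => i; rewrite tnth_rcons_lift.
  exists (QExists phi) => e /=.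
  by split=> [/existsP [x /Hx Px]|[x /Hx Px]]; [exists x|apply/existsP; exists x].
- move=> I P _ IP r g.
  have [phi Hphi] := IP r.+1 (oapp (lift ord_max \o g) ord_max).
  have Hx (e : r.-tuple A) x : qsat R phi [tuple of rcons e x] <-> P (fun i => tnth e (g i)) x.
    rewrite Hphi /= tnth_rcons_max (_ : (fun i => _) = (fun i => tnth e (g i))) //.
    by apply/funext => i; rewrite tnth_rcons_lift.
  exists (QForall phi) => e /=.
  by split=> [/forallP h x|h]; [apply/Hx|apply/forallP => x; apply/Hx].
Qed.

Lemma qdef_qdefinable (r : nat) (P : {set r.-tuple A}) :
  qdef (fun e : 'I_r -> A => [tuple e i | i < r] \in P) -> qdefinable R P.
Proof.
move=> /(@qdef_prenex _ _ r id) [phi Hphi]; exists phi; apply/setP => e; rewrite inE.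
have -> : (e \in P) = ([tuple tnth e i | i < r] \in P).
  by congr (_ \in P); apply: eq_from_tnth => i; rewrite tnth_map tnth_ord_tuple.
by apply/idP/idP => /Hphi.
Qed.

End Definability.

(** * Families of relations parametrized by z and alpha *)

Section Admissible.

Variables (A : finType) (N : nat) (R : {set N.-tuple A}).
Variables (Var : eqType) (Sol : {ffun A -> A} -> (Var -> A) -> Prop).

Notation Z := {ffun A -> A}.
Notation rel_fam I := (Z -> (A -> A) -> (I -> A) -> Prop).

(** [z] and [al] are read off two blocks of variables indexed by [A]. Thus alpha has length |A|,
    which makes the identity one of its values. *)
Definition par_qdef (I : finType) (P : rel_fam I) : Prop :=
  @qdef A N R (A + (A + I))%type
    (fun e => P [ffun a => e (inl a)] (fun a => e (inr (inl a)))
                (fun i => e (inr (inr i)))).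

(* By the second condition the intersection over all al is the value at al = id;
   by the third, every relation holds along the solutions in Sol when al is
   constant. These are the "forall forall" and "forall" levels of the paper. *)
Definition adm (I : finType) (lab : I -> Var) (P : rel_fam I) : Prop :=
  [/\ par_qdef P,
      forall z al e, P z id e -> P z al e &
      forall z f c, Sol z f -> P z (fun _ => c) (fun i => f (lab i))].

Lemma adm_iff (I : finType) (lab : I -> Var) (P Q : rel_fam I) :
  (forall z al e, P z al e <-> Q z al e) -> adm lab P -> adm lab Q.
Proof.
move=> PQ; suff -> : P = Q by [].
by apply/funext => z; apply/funext => al; apply/funext => e; apply/propext.
Qed.

Lemma adm_true (I : finType) (lab : I -> Var) : adm lab (fun _ _ _ => True).
Proof. by split=> //; exact: qdef_true. Qed.

Lemma adm_and (I : finType) (lab : I -> Var) (P Q : rel_fam I) :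
  adm lab P -> adm lab Q -> adm lab (fun z al e => P z al e /\ Q z al e).
Proof.
move=> [qP mP sP] [qQ mQ sQ]; split=> [|z al e [/mP Pe /mQ Qe]|z f c Sf] //.
- exact: qdef_and.
- by split; [apply: sP|apply: sQ].
Qed.

Lemma adm_sub (I J : finType) (lab : I -> Var) (lab' : J -> Var) (g : I -> J)
    (P : rel_fam I) :
  (forall i, lab' (g i) = lab i) -> adm lab P ->
  adm lab' (fun z al e => P z al (fun i => e (g i))).
Proof.
move=> lg [qP mP sP]; split=> [|z al e|z f c Sf]; last 2 first.
- exact: mP.
- by rewrite (_ : (fun i => _) = (fun i => f (lab i))); [exact: sP|apply/funext => i; rewrite lg].
pose g' (x : A + (A + I)) : A + (A + J) :=
  match x with
  | inl a => inl a | inr (inl a) => inr (inl a) | inr (inr i) => inr (inr (g i))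
  end.
exact: (qdef_sub g' qP).
Qed.

(** The labels of bound variables name their witnesses: along a solution [f], the variable [w] takes
    the value [f (labW w)]. *)
Lemma adm_ex_fin (I W : finType) (lab : I -> Var) (labW : W -> Var)
    (P : Z -> (A -> A) -> (I -> A) -> (W -> A) -> Prop) :
  @adm (I + W)%type (fun x => match x with inl i => lab i | inr w => labW w end)
    (fun z al e => P z al (fun i => e (inl i)) (fun w => e (inr w))) ->
  adm lab (fun z al e => exists b, P z al e b).
Proof.
move=> [qP mP sP]; split=> [|z al e [b Pb]|z f c Sf]; last 2 first.
- exists b; have := mP z al (env_cat e b); exact.
- by exists (fun w => f (labW w)); exact: (sP z f c Sf).
apply: (@qdef_ex_fin _ _ _ _ W (fun e b => P [ffun a => e (inl a)]
  (fun a => e (inr (inl a))) (fun i => e (inr (inr i))) b)).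
pose g (x : A + (A + (I + W))) : (A + (A + I)) + W :=
  match x with
  | inl a => inl (inl a)
  | inr (inl a) => inl (inr (inl a))
  | inr (inr (inl i)) => inl (inr (inr i))
  | inr (inr (inr w)) => inr w
  end.
exact: (qdef_sub g qP).
Qed.

Lemma adm_ex (I : finType) (lab : I -> Var) (v : Var)
    (P : Z -> (A -> A) -> (I -> A) -> A -> Prop) :
  @adm (option I) (fun x => if x is Some i then lab i else v)
    (fun z al e => P z al (fun i => e (Some i)) (e None)) ->
  adm lab (fun z al e => exists x, P z al e x).
Proof.
move=> aP; suff: adm lab (fun z al e => exists b : unit -> A, P z al e (b tt)).
  by apply: adm_iff => z al e; split=> [[b Pb]|[x Px]]; [exists (b tt)|exists (fun=> x)].
apply: (@adm_ex_fin I unit lab (fun=> v) (fun z al e b => P z al e (b tt))).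
pose g (x : option I) : I + unit := if x is Some i then inl i else inr tt.
by apply: (adm_sub (g := g)) aP => -[].
Qed.

Lemma adm_forall_fin (I W : finType) (lab : I -> Var) (P : W -> rel_fam I) :
  (forall w, adm lab (P w)) -> adm lab (fun z al e => forall w, P w z al e).
Proof.
move=> aP; split=> [|z al e h w|z f c Sf w].
- by apply: qdef_forall_fin => w; have [] := aP w.
- by have [_ mP _] := aP w; apply: mP.
- by have [_ _ sP] := aP w; apply: sP.
Qed.

Lemma adm_imp (I : finType) (lab : I -> Var) (b : bool) (P : rel_fam I) :
  (b -> adm lab P) -> adm lab (fun z al e => b -> P z al e).
Proof.
case: b => aP; last by apply: adm_iff (adm_true lab).
by apply: adm_iff (aP isT) => z al e; split=> // h; exact: h.
Qed.

(** The passage to constant [al] is definable: all |A| parameters become one universally quantified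
    variable. *)
Lemma adm_const (I : finType) (lab : I -> Var) (P : rel_fam I) :
  adm lab P -> adm lab (fun z _ e => forall c, P z (fun _ => c) e).
Proof.
move=> [qP mP sP]; split=> [|z al e|z f c Sf c'] //; last exact: sP.
apply: (@qdef_all _ _ _ _ (fun e x => P [ffun a => e (inl a)]
  (fun a => x) (fun i => e (inr (inr i))))).
pose g (x : A + (A + I)) : option (A + (A + I)) :=
  match x with
  | inl a => Some (inl a) | inr (inl a) => None | inr (inr i) => Some (inr (inr i))
  end.
exact: (qdef_sub g qP).
Qed.

Lemma adm_mono (I : finType) (lab : I -> Var) (P : rel_fam I) z al e :
  adm lab P -> P z id e -> P z al e.
Proof. by move=> [_ mP _]; exact: mP. Qed.

Lemma adm_sol (I : finType) (lab : I -> Var) (P : rel_fam I) z f c :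
  adm lab P -> Sol z f -> P z (fun _ => c) (fun i => f (lab i)).
Proof. by move=> [_ _ sP]; exact: sP. Qed.

Notation fam1 := (Z -> (A -> A) -> A -> Prop).
Notation fam2 := (Z -> (A -> A) -> A -> A -> Prop).

Definition adm1 (v : Var) (U : fam1) : Prop :=
  @adm unit (fun _ => v) (fun z al e => U z al (e tt)).

Definition adm2 (u v : Var) (Q : fam2) : Prop :=
  @adm bool (fun b => if b then v else u) (fun z al e => Q z al (e false) (e true)).

Lemma adm1_at (I : finType) (lab : I -> Var) (i : I) (U : fam1) :
  adm1 (lab i) U -> adm lab (fun z al e => U z al (e i)).
Proof. exact: (@adm_sub unit I _ lab (fun=> i)). Qed.

Lemma adm2_at (I : finType) (lab : I -> Var) (i j : I) (Q : fam2) :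
  adm2 (lab i) (lab j) Q -> adm lab (fun z al e => Q z al (e i) (e j)).
Proof. by apply: (@adm_sub bool I _ lab (fun b => if b then j else i)) => -[]. Qed.

Definition image (U : fam1) (Q : fam2) : fam1 :=
  fun z al y => exists x, U z al x /\ Q z al x y.
Definition meet1 (U W : fam1) : fam1 := fun z al x => U z al x /\ W z al x.
Definition comp (P Q : fam2) : fam2 :=
  fun z al x y => exists t, P z al x t /\ Q z al t y.
Definition inv (Q : fam2) : fam2 := fun z al x y => Q z al y x.

Lemma adm_image u v U Q : adm1 u U -> adm2 u v Q -> adm1 v (image U Q).
Proof.
move=> aU aQ; apply: (adm_ex (v := u)).
by apply: adm_and; [apply: adm1_at|apply: (adm2_at (i := None) (j := Some tt))].
Qed.

Lemma adm_meet1 v U W : adm1 v U -> adm1 v W -> adm1 v (meet1 U W).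
Proof. exact: adm_and. Qed.

Lemma adm_comp u v w P Q : adm2 u v P -> adm2 v w Q -> adm2 u w (comp P Q).
Proof.
move=> aP aQ; apply: (adm_ex (v := v)).
apply: adm_and; first exact: (adm2_at (i := Some false) (j := None)).
exact: (adm2_at (i := None) (j := Some true)).
Qed.

Lemma adm_inv u v Q : adm2 u v Q -> adm2 v u (inv Q).
Proof. by move=> aQ; apply: (adm2_at (i := true) (j := false)). Qed.

End Admissible.

Lemma finset_stabilizes (T : finType) (s : nat -> {set T}) :
  (forall t, s t.+1 \subset s t) -> exists t, s t.+1 = s t.
Proof.
move=> decr; apply: contrapT => nst.
have card_le t : #|s t| + t <= #|s 0|.
  elim: t => [|t IH]; first by rewrite addn0.
  apply: leq_trans IH; rewrite addnS -addSn leq_add2r; apply: proper_card.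
  rewrite properEneq decr andbT; apply/eqP => e; apply: nst; by exists t.
by have := card_le #|s 0|.+1; rewrite addnS ltnNge leq_addl.
Qed.

Lemma uniform_bound (T : finType) (P : T -> nat -> Prop) :
  (forall t, exists m, forall m', m <= m' -> P t m') ->
  exists m, forall t, P t m.
Proof.
move=> /choice [b Pb]; exists (\max_t b t) => t; apply: Pb; exact: leq_bigmax.
Qed.

Section Projections.

Variables (A : finType) (N : nat) (R : {set N.-tuple A}).
Variables (Var : eqType) (Sol : {ffun A -> A} -> (Var -> A) -> Prop).
Variables (W : finType) (h : W -> Var).

Notation Z := {ffun A -> A}.
Notation adm := (adm R Sol).

Implicit Type T : Z -> (A -> A) -> (W -> A) -> Prop.

Definition pr1 T (m : W) : Z -> (A -> A) -> A -> Prop :=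
  fun z al x => exists a, T z al a /\ a m = x.

Definition pr2 T (l m : W) : Z -> (A -> A) -> A -> A -> Prop :=
  fun z al x y => exists a, [/\ T z al a, a l = x & a m = y].

(** The equation [a m = x] is not an atom; it is removed by substituting the free variable for [a m]
    under the quantifier. *)
Lemma adm_pr1 T m : adm h T -> adm1 R Sol (h m) (pr1 T m).
Proof.
move=> aT; rewrite /adm1.
suff : adm (fun _ : unit => h m) (fun z al e =>
    exists a : W -> A, T z al (fun w => if w == m then e tt else a w)).
  apply: adm_iff => z al e; split=> [[a Ta]|[a [Ta <-]]]; last first.
    by exists a; rewrite (_ : (fun w => _) = a) //; apply/funext => w; case: eqP => [->|].
  by eexists; split; [exact: Ta|rewrite /= eqxx].
apply: (adm_ex_fin (labW := h)).
apply: (adm_iff (P := fun z al e => T z al (fun w => e (if w == m then inl tt else inr w)))).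
  move=> z al e; rewrite (_ : (fun w => _) =
    (fun w => if w == m then e (inl tt) else e (inr w))) //.
  by apply/funext => w; case: eqP.
by apply: adm_sub aT => w; case: eqP => [->|].
Qed.

(** The coordinates must differ: for [l = m] the projection lies in the diagonal, and equality is
    not an atom. *)
Lemma adm_pr2 T l m : l != m -> adm h T -> adm2 R Sol (h l) (h m) (pr2 T l m).
Proof.
move=> lm aT; rewrite /adm2.
pose mix (e : bool -> A) (a : W -> A) w :=
  if w == l then e false else if w == m then e true else a w.
suff : adm (fun b : bool => if b then h m else h l) (fun z al e =>
    exists a : W -> A, T z al (mix e a)).
  apply: adm_iff => z al e; split=> [[a Ta]|[a [Ta el em]]]; last first.
    exists a; rewrite (_ : mix e a = a) //; apply/funext => w; rewrite /mix -el -em.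
    by case: eqP => [->|] //; case: eqP => [->|].
  exists (mix e a); split=> //; rewrite /mix ?eqxx //.
  by rewrite eq_sym (negbTE lm).
apply: (adm_ex_fin (labW := h)).
apply: (adm_iff (P := fun z al e => T z al (fun w => e
    (if w == l then inl false else if w == m then inl true else inr w)))).
  move=> z al e; rewrite (_ : (fun w => _) =
    mix (fun b => e (inl b)) (fun w => e (inr w))) //.
  by apply/funext => w; rewrite /mix; case: eqP => //; case: eqP.
by apply: adm_sub aT => w; case: eqP => [->|] //; case: eqP => [->|].
Qed.

End Projections.

(** * Definable subsets of a minimal domain *)

Section OneSort.

Variables (A : finType) (N : nat) (R : {set N.-tuple A}).
Variables (Var : eqType) (Sol : {ffun A -> A} -> (Var -> A) -> Prop).

Notation Z := {ffun A -> A}.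
Notation fam1 := (Z -> (A -> A) -> A -> Prop).
Notation fam2 := (Z -> (A -> A) -> A -> A -> Prop).
Notation adm := (adm R Sol).
Notation adm1 := (adm1 R Sol).
Notation adm2 := (adm2 R Sol).

(** Families are compared at [al = id] only, which stands for the intersection over all alpha. *)
Definition sub1 (U W : fam1) : Prop := forall z x, U z id x -> W z id x.
Definition eq1 (U W : fam1) : Prop := forall z x, U z id x <-> W z id x.
Definition inhab (U : fam1) : Prop := forall z, exists x, U z id x.
Definition const_level (Q : fam2) (z : Z) (x y : A) : Prop :=
  forall c, Q z (fun _ => c) x y.
Definition reached (v : Var) (z : Z) (x : A) : Prop :=
  exists2 f, Sol z f & f v = x.

(** The set D of the mighty tuple is the common projection of [Q] at [id]; its inclusion in
    [reached] yields condition 1 through the third clause of [adm]. *)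
Definition no_mightyV (v : Var) : Prop := forall Q : fam2, adm2 v v Q ->
  (forall z, exists x y, Q z id x y) ->
  (forall z x y, Q z id x y -> reached v z x) ->
  (forall z x y, Q z id x y -> exists t, Q z id y t) ->
  (forall z x y, Q z id x y -> exists t, Q z id t x) ->
  forall z, exists x, Q z id x x.

(** Condition 3 is asked as an inclusion only; [mightyIV_rule] turns it into an equality by
    restricting [Q] to [D]. *)
Definition no_mightyIV (v : Var) : Prop := forall (Q : fam2) (D U C : fam1),
  adm2 v v Q -> adm1 v D -> adm1 v U -> adm1 v C ->
  inhab U -> sub1 U D -> inhab C -> sub1 C D ->
  eq1 (image U Q) U -> eq1 (image D Q) D ->
  (forall z y, D z id y -> exists2 x, U z id x & const_level Q z x y) ->
  inhab (meet1 U C).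

Definition code1 (U : fam1) : {set Z * A} := [set p | `[< U p.1 id p.2 >]].

Lemma mem_code1 U z x : ((z, x) \in code1 U) = `[< U z id x >].
Proof. by rewrite inE. Qed.

Lemma code1_eq U W : code1 U = code1 W -> eq1 U W.
Proof.
move=> e z x; apply: asbool_eq_equiv; by rewrite -!mem_code1 e.
Qed.

Variable v : Var.
Hypothesis ruleV : no_mightyV v.
Hypothesis ruleIV : no_mightyIV v.
Variable V : fam1.
Hypothesis admV : adm1 v V.
Hypothesis V0 : inhab V.
Hypothesis V_reached : forall z x, V z id x -> reached v z x.

Definition smooth (Q : fam2) : Prop :=
  [/\ forall z x y, Q z id x y -> V z id x /\ V z id y,
      forall z x, V z id x -> exists y, Q z id x y &
      forall z y, V z id y -> exists x, Q z id x y].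

Lemma const_refl Q z x : adm2 v v Q -> reached v z x -> const_level Q z x x.
Proof.
move=> aQ [f Sf <-] c; have := adm_sol c aQ Sf => /=; exact.
Qed.

Lemma const_of_id Q z x y : adm2 v v Q -> Q z id x y -> const_level Q z x y.
Proof.
move=> aQ Qxy c; have := @adm_mono _ _ _ _ _ _ _ _ z (fun _ => c) (fun b => if b then y else x) aQ.
exact.
Qed.

(** [Y t] is the set of starting points of [Q]-paths of length [t]; it is nonempty because paths can
    be prolonged backwards. On the stable value of [Y] the relation [Q] is subdirect, so [ruleV]
    gives a loop there. *)
Lemma loop_of_total Q : adm2 v v Q ->
  (forall z x y, Q z id x y -> V z id x /\ V z id y) ->
  (forall z y, V z id y -> exists x, Q z id x y) ->
  forall z, exists x, Q z id x x.
Proof.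
move=> aQ QV Qpre.
pose Y := fix Y t := if t is t'.+1 then image (Y t') (inv Q) else V.
have aY t : adm1 v (Y t) by elim: t => [|t IH] //=; apply: adm_image IH (adm_inv aQ).
have decr t : sub1 (Y t.+1) (Y t).
  elim: t => [|t IH] z x [y [Yy Qxy]]; first by have [] := QV _ _ _ Qxy.
  by exists y; split=> //; apply: IH.
have [t et] : exists t, code1 (Y t.+1) = code1 (Y t).
  apply: finset_stabilizes => t; apply/subsetP => -[z x].
  by rewrite !mem_code1 => /asboolP /decr /asboolP.
have st := code1_eq et.
have YV z x : Y t z id x -> V z id x.
  by elim: (t) x => [|t' IH] x //= [y [/IH _]]; rewrite /inv => /QV [].
have Yne s : inhab (Y s).
  move=> z; suff h y : V z id y -> exists x, Y s z id x by have [y /h] := V0 z.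
  have [y0 Vy0] := V0 z.
  elim: s => [|s IH] Vy; first by exists y.
  have [x Yx] := IH Vy.
  have Vx : V z id x by elim: (s) x Yx => [|s' IH'] x //= [u [_]]; rewrite /inv => /QV [].
  by have [u Qux] := Qpre _ _ Vx; exists u, x.
pose Q' : fam2 := fun z al x y => Q z al x y /\ (Y t z al x /\ Y t z al y).
have aQ' : adm2 v v Q'.
  apply: adm_and => //.
  by apply: adm_and; [apply: (adm1_at (i := false))|apply: (adm1_at (i := true))].
suff loops : forall z, exists x, Q' z id x x by move=> z; have [x [? _]] := loops z; exists x.
apply: (ruleV aQ').
- move=> z; have [x /st [y [Yy Qxy]]] := Yne t z; exists x, y.
  by split=> //; split=> //; apply/st; exists y.
- by move=> z x y [_ [/YV /V_reached]].
- move=> z x y [_ [_ /st [u [Yu Qyu]]]]; exists u; split=> //; split=> //.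
  by apply/st; exists u.
- move=> z x y [_ [Yx _]]; have [u Qux] := Qpre _ _ (YV _ _ Yx).
  by exists u; split=> //; split=> //; apply/st; exists x.
Qed.

(** * Walks at constant alpha and good relations *)

Definition edge (Q : fam2) (z : Z) (x y : A) : Prop :=
  [/\ reached v z x, reached v z y & const_level Q z x y].

Fixpoint walk (Q : fam2) (m : nat) (z : Z) (x y : A) : Prop :=
  if m is m'.+1 then exists2 t, edge Q z x t & walk Q m' z t y else x = y.

Fixpoint power (Q : fam2) (m : nat) : fam2 :=
  if m is m'.+1 then comp Q (power Q m') else Q.

(* Closure under an edge relation is what condition 3 of a mighty tuple IV asks
   of a set B, after passing to a power of Q. *)
Definition good (Q : fam2) : Prop := forall U : fam1,
  adm1 v U -> inhab U -> sub1 U V ->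
  forall z y, V z id y -> exists m x, U z id x /\ walk Q m z x y.

Lemma edge_refl Q z x : adm2 v v Q -> reached v z x -> edge Q z x x.
Proof. by move=> aQ rx; split=> //; exact: const_refl. Qed.

Lemma walk_pad Q m m' z x y : adm2 v v Q -> reached v z x ->
  m <= m' -> walk Q m z x y -> walk Q m' z x y.
Proof.
move=> aQ rx /subnK <-; elim: (m' - m) => [|d IH] // w.
by exists x; [exact: edge_refl|exact: IH].
Qed.

Lemma walk_mono Q Q' m z x y :
  (forall x y, edge Q z x y -> edge Q' z x y) -> walk Q m z x y -> walk Q' m z x y.
Proof.
move=> QQ'; elim: m x => [|m IH] x //= [t /QQ' e /IH w]; by exists t.
Qed.

Lemma good_mono Q Q' :
  (forall z x y, edge Q z x y -> edge Q' z x y) -> good Q -> good Q'.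
Proof.
move=> QQ' gQ U aU U0 UV z y /(gQ U aU U0 UV) [m [x [Ux w]]].
by exists m, x; split=> //; apply: walk_mono w; exact: QQ'.
Qed.

Lemma good_comp_r P Q : adm2 v v P -> good Q -> good (comp P Q).
Proof.
move=> aP; apply: good_mono => z x y [rx ry Qxy]; split=> // c.
by exists x; split; [exact: const_refl|exact: Qxy].
Qed.

Lemma adm_power Q m : adm2 v v Q -> adm2 v v (power Q m).
Proof. by move=> aQ; elim: m => [|m IH] //=; exact: adm_comp aQ IH. Qed.

Lemma walk_power Q m z x y : walk Q m.+1 z x y -> const_level (power Q m) z x y.
Proof.
elim: m x => [|m IH] x; first by move=> [t [_ _ Qxt] <-].
by move=> [t [_ _ Qxt] /IH w] c; exists t.
Qed.

Lemma image_power U Q m : eq1 (image U Q) U -> eq1 (image U (power Q m)) U.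
Proof.
move=> UQ; elim: m => [|m IH] //= z y; split.
  move=> [x [Ux [t [Qxt w]]]]; apply/IH; exists t; split=> //.
  by apply/UQ; exists x.
move=> /IH [t [/UQ [x [Ux Qxt]] w]]; exists x; split=> //; by exists t.
Qed.

(** Walks from [U] reach all of [V], and padding them with loops gives one length for all endpoints.
    A power of [Q] then satisfies condition 3 of a mighty tuple IV, while [U] and [D] stay fixed by
    it. *)
Lemma closed_set_dense Q (D U C : fam1) :
  adm2 v v Q -> good Q -> adm1 v D -> adm1 v U -> adm1 v C ->
  inhab U -> sub1 U D -> sub1 D V -> inhab C -> sub1 C D ->
  eq1 (image U Q) U -> eq1 (image D Q) D -> inhab (meet1 U C).
Proof.
move=> aQ gQ aD aU aC U0 UD DV C0 CD UQ DQ.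
have UV : sub1 U V by move=> z x /UD /DV.
have [m Hm] : exists m, forall p : Z * A,
    V p.1 id p.2 -> exists2 x, U p.1 id x & walk Q m.+1 p.1 x p.2.
  apply: (@uniform_bound _ (fun (p : Z * A) m =>
    V p.1 id p.2 -> exists2 x, U p.1 id x & walk Q m.+1 p.1 x p.2)) => -[z y] /=.
  case: (lem (V z id y)) => [/(gQ U aU U0 UV) [m [x [Ux w]]]|nV]; last by exists 0.
  exists m => m' mm' _; exists x => //.
  have rx : reached v z x by exact/V_reached/UV.
  exact: (walk_pad aQ rx (leqW mm') w).
apply: (ruleIV (Q := power Q m) (D := D)) => //.
- exact: adm_power.
- exact: image_power.
- exact: image_power.
- by move=> z y /DV /(Hm (z, y)) [x Ux /walk_power w]; exists x.
Qed.

(** * Live pairs and the depth of their propagation *)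

Definition okp (S X : fam1) : Prop :=
  [/\ adm1 v S, adm1 v X, inhab X, sub1 X S & sub1 S V].

(* When X and S are followed along good steps, a set C reached from S but missed
   by X can be pulled back, so no live pair can recur: a recurrence would be a
   mighty tuple IV. *)
Definition live (S X : fam1) : Prop := exists C : fam1,
  [/\ adm1 v C, inhab C, sub1 C S & exists z, forall x, C z id x -> ~ X z id x].

Definition step (S X S' X' : fam1) : Prop := exists P : fam2,
  [/\ adm2 v v P, good P,
      forall z x y, P z id x y -> S z id x /\ S' z id y,
      (forall z x, S z id x -> exists y, P z id x y) /\ eq1 (image S P) S' &
      eq1 (image X P) X'].

Lemma step_trans S X S' X' S2 X2 :
  step S X S' X' -> step S' X' S2 X2 -> step S X S2 X2.
Proof.
move=> [P [aP gP Pd [Pt SP] XP]] [Q [aQ gQ Qd [Qt SQ] XQ]].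
exists (comp P Q); split.
- exact: adm_comp aP aQ.
- exact: good_comp_r.
- by move=> z x y [t [/Pd [Sx _] /Qd [_ Sy]]].
- split=> [z x /Pt [t Pxt]|z y].
    by have [_ /Qt [y Qty]] := Pd _ _ _ Pxt; exists y, t.
  split=> [[x [Sx [t [_ /Qd [_ Sy]]]]] //|/SQ [t [/SP [x [Sx Pxt]] Qty]]].
  by exists x; split=> //; exists t.
- move=> z y; split=> [[x [Xx [t [Pxt Qty]]]]|/XQ [t [/XP [x [Xx Pxt]] Qty]]].
    by apply/XQ; exists t; split=> //; apply/XP; exists x.
  by exists x; split=> //; exists t.
Qed.

Lemma step_loop_dead S X S' X' :
  okp S X -> step S X S' X' -> eq1 S S' -> eq1 X X' -> ~ live S X.
Proof.
move=> [aS aX X0 XS SV] [P [aP gP Pd [Pt SP] XP]] eS eX [C [aC C0 CS [z0 dis]]].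
suff /(_ z0) [x [Xx Cx]] : inhab (meet1 X C) by apply: dis Cx Xx.
apply: (closed_set_dense aP gP aS) => //.
- by move=> z y; split=> [/XP /eX|/eX /XP].
- by move=> z y; split=> [/SP /eS|/eS /SP].
Qed.

Lemma live_step S X S' X' : step S X S' X' -> live S' X' -> live S X.
Proof.
move=> [P [aP gP Pd [Pt SP] XP]] [C [aC C0 CS [z0 dis]]].
exists (image C (inv P)); split.
- exact: adm_image aC (adm_inv aP).
- move=> z; have [y Cy] := C0 z; have /SP [x [_ Pxy]] := CS _ _ Cy.
  by exists x, y.
- by move=> z x [y [_ /Pd []]].
- exists z0 => x [y [Cy Pxy]] Xx; apply: (dis _ Cy); apply/XP; by exists x.
Qed.

Fixpoint depth (n : nat) (S X : fam1) : Prop :=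
  okp S X /\
  if n is m.+1 then exists S0 X0, depth m S0 X0 /\ step S0 X0 S X else True.

Lemma depth_okp n S X : depth n S X -> okp S X.
Proof. by case: n => [|n] []. Qed.

Definition depth_bound : nat := #|{: {set Z * A} * {set Z * A}}|.

(** All pairs on a chain ending in a live pair are live by [live_step]. Two of them with equal codes
    would be joined by a step contradicting [step_loop_dead], so the chain is no longer than the
    number of codes. *)
Lemma depth_bounded n S X : depth n S X -> live S X -> n < depth_bound.
Proof.
suff : depth n S X -> live S X -> exists L : seq ({set Z * A} * {set Z * A}),
    [/\ uniq L, size L = n.+1 & forall c, c \in L -> c = (code1 S, code1 X) \/
      exists S0 X0, [/\ okp S0 X0, c = (code1 S0, code1 X0) & step S0 X0 S X]].
  move=> h /h{}h /h [L [uL sL _]].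
  by rewrite /depth_bound -sL cardE; apply: uniq_leq_size => // c; rewrite mem_enum.
elim: n S X => [|n IH] S X.
  move=> _ _; exists [:: (code1 S, code1 X)]; split=> // c.
  by rewrite inE => /eqP ->; left.
move=> [ok [S0 [X0 [D0 st]]]] lv.
have [L [uL sL HL]] := IH _ _ D0 (live_step st lv).
have HL' c : c \in L -> exists S1 X1,
    [/\ okp S1 X1, c = (code1 S1, code1 X1) & step S1 X1 S X].
  move=> /HL [->|[S1 [X1 [ok1 -> st1]]]].
    by exists S0, X0; split=> //; exact: depth_okp D0.
  by exists S1, X1; split=> //; exact: step_trans st1 st.
exists ((code1 S, code1 X) :: L); split=> /=.
- rewrite uL andbT; apply/negP => /HL' [S1 [X1 [ok1 [cS cX] st1]]].
  have eS := code1_eq cS; have eX := code1_eq cX.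
  apply: (step_loop_dead ok1 st1); last exact: live_step st1 lv.
  + by move=> z x; split=> /eS.
  + by move=> z x; split=> /eX.
- by rewrite sL.
- by move=> c; rewrite inE => /predU1P [->|/HL' h]; [left|right].
Qed.

(** [T] is pulled back along the whole chain, and each step is restricted to end in it. *)
Lemma depth_restrict n S X T : depth n S X -> adm1 v T -> sub1 T S ->
  inhab (meet1 X T) -> depth n T (meet1 X T).
Proof.
elim: n S X T => [|n IH] S X T [[aS aX X0 XS SV] D] aT TS XT.
  split=> //; split=> //; [exact: adm_meet1|by move=> z x []|by move=> z x /TS /SV].
split; first by split=> //; [exact: adm_meet1|by move=> z x []|by move=> z x /TS /SV].
move: D => [S0 [Y0 [D0 [P [aP gP Pd [Pt SP] XP]]]]].
pose T0 : fam1 := image T (inv P).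
have aT0 : adm1 v T0 by apply: adm_image aT (adm_inv aP).
have T0S : sub1 T0 S0 by move=> z x [y [_ /Pd []]].
exists T0, (meet1 Y0 T0); split.
  apply: (IH _ _ _ D0) => // z; have [y [/XP [x [Yx Pxy]] Ty]] := XT z.
  by exists x; split=> //; exists y.
exists (fun z al x y => P z al x y /\ T z al y); split.
- by apply: adm_and => //; apply: (adm1_at (i := true)).
(* At constant [al] the added conjunct [T] holds at every reached value, so no edge is lost. *)
- apply: good_mono gP => z x y [rx ry Pxy]; split=> // c; split=> //.
  by have [f Sf <-] := ry; exact: (adm_sol c aT Sf).
- by move=> z x y [Pxy Ty]; split=> //; exists y.
- split=> [z x [y [Ty Pxy]]|z y]; first by exists y.
  split=> [[x [_ []]] //|Ty]; have /SP [x [Sx Pxy]] := TS _ _ Ty.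
  by exists x; split=> //; exists y.
- move=> z y; split=> [[x [[Yx _] [Pxy Ty]]]|[/XP [x [Yx Pxy]] Ty]].
    by split=> //; apply/XP; exists x.
  by exists x; split=> //; split=> //; exists y.
Qed.

(** * Marked vertices of tree formulas *)

Section Marked.

Variables (W : finType) (h : W -> Var).
Variables (T : Z -> (A -> A) -> (W -> A) -> Prop) (X : fam1).

Definition marked (S : {set W}) : Z -> (A -> A) -> (W -> A) -> Prop :=
  fun z al a => T z al a /\ forall l, (l \in S) && (h l == v) -> X z al (a l).

Lemma adm_marked S : adm h T -> adm1 v X -> adm h (marked S).
Proof.
move=> aT aX; apply: adm_and => //; apply: adm_forall_fin => l.
by apply: adm_imp => /andP [_ /eqP hl]; apply: adm1_at; rewrite hl.
Qed.

Lemma markedD1 S l z al a : marked S z al a -> marked (S :\ l) z al a.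
Proof.
move=> [Ta Xa]; split=> // u; rewrite in_setD1 -andbA => /andP [_]; exact: Xa.
Qed.

Lemma marked_add S l z al a :
  marked (S :\ l) z al a -> X z al (a l) -> marked S z al a.
Proof.
move=> [Ta Xa] Xl; split=> // u /andP [uS hu].
by case: (eqVneq u l) => [->|ul] //; apply: Xa; rewrite in_setD1 ul uS.
Qed.

End Marked.

(** This is all that is used of a tree formula over the instance: its projection to every vertex
    labelled [v] is exactly [V]. *)
Definition tree_like (W : finType) (h : W -> Var)
    (T : Z -> (A -> A) -> (W -> A) -> Prop) : Prop :=
  [/\ adm h T, forall z, exists a, T z id a,
      forall z w x, h w = v -> V z id x -> exists a, T z id a /\ a w = x &
      forall z w a, h w = v -> T z id a -> V z id (a w)].

(** The form in which minimality of the reduction enters; [minimal_tree] provides it. *)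
Hypothesis minV : forall X : fam1,
  adm1 v X -> inhab X -> sub1 X V -> ~ sub1 V X ->
  exists (W : finType) (h : W -> Var) T, tree_like h T /\
    exists z, forall a : W -> A, T z id a -> ~ forall w, h w = v -> X z id (a w).

(* X consists of the values at which a formula keeps a solution after two of its
   variables s and s' have been identified, and G relates these values to s'
   alone, before the identification; the last clause then comes from the absence
   of mighty tuples V. *)
Definition mark (X : fam1) (G : fam2) : Prop :=
  [/\ adm1 v X /\ sub1 X V, adm2 v v G, smooth G, good G &
      forall Zs : fam1, adm1 v Zs -> sub1 Zs V -> sub1 V (image Zs G) ->
        inhab (meet1 X Zs)].

(** If every inhabited definable subset of [V] met [X] for every [z], the vertices of the tree from
    [minV] could be put into [X] one at a time. *)
Lemma proper_live X : adm1 v X -> inhab X -> sub1 X V -> ~ sub1 V X -> live V X.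
Proof.
move=> aX X0 XV nVX; have [W [h [T [[aT T0 Tx TV] [z0 Hz]]]]] := minV aX X0 XV nVX.
apply: contrapT => nlive.
suff /(_ setT z0) [a [Ta Xa]] : forall S z, exists a, marked h T X S z id a.
  by apply: (Hz a) => // w hw; apply: Xa; rewrite inE hw eqxx.
move=> S; have [k] := ubnP #|S|; elim: k S => // k IH S ltSk.
have [->|[l lS]] := set_0Vmem S.
  by move=> z; have [a Ta] := T0 z; exists a; split=> // l; rewrite inE.
have IHl : forall z, exists a, marked h T X (S :\ l) z id a.
  by apply: IH; rewrite (cardsD1 l) lS in ltSk.
case: (eqVneq (h l) v) => [hl|hl]; last first.
  move=> z; have [a [Ta Xa]] := IHl z; exists a; split=> // u /andP [uS hu].
  by apply: Xa; rewrite in_setD1 uS hu andbT andbT; apply: contraNneq hl => <-.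
move=> z; apply: contrapT => nz; apply: nlive.
exists (pr1 (marked h T X (S :\ l)) l); split.
- by rewrite -hl; apply: adm_pr1; apply: adm_marked.
- by move=> z1; have [a ma] := IHl z1; exists (a l), a.
- by move=> z1 x [a [[Ta _] <-]]; exact: TV.
- exists z => x [a [ma <-]] Xl; apply: nz; exists a; exact: marked_add ma Xl.
Qed.

Section Propagation.

Variables (n : nat) (X : fam1) (G : fam2).
Hypothesis markXG : mark X G.
Hypothesis depthX : depth n V X.
Hypothesis deeper : forall X' G', mark X' G' -> depth n.+1 V X' -> sub1 V X'.
Variables (W : finType) (h : W -> Var) (T : Z -> (A -> A) -> (W -> A) -> Prop).
Hypothesis treeT : tree_like h T.

(* The information carried by the marks on S never survives one further good
   step: otherwise it would define a mark of larger depth. *)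
Lemma marks_invisible (S : {set W}) (m : W) :
  (forall l, l \in S -> h l = v) -> h m = v -> m \notin S ->
  sub1 V (image (pr1 (marked h T X S) m) G).
Proof.
have [[aX XV] aG sG gG meetX] := markXG; have [GV Gt Gs] := sG.
have [aT T0 Tx TV] := treeT.
have [k] := ubnP #|S|; elim: k S m => // k IH S m ltSk Sv hm mS.
have [S0|[l lS]] := set_0Vmem S.
  move=> z y Vy; have [x Gxy] := Gs _ _ Vy; have [Vx _] := GV _ _ _ Gxy.
  have [a [Ta am]] := Tx _ _ _ hm Vx; exists x; split=> //; exists a.
  by split=> //; split=> // u; rewrite S0 inE.
(* One mark is put aside. With the others alone, both [l] and [m] cover [V] after a step of [G]; the
   set [X] at [l] is then transported to [m] along the tree. *)
pose S' := S :\ l.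
have ltS' : #|S'| < k by rewrite (cardsD1 l) lS in ltSk.
have S'v u : u \in S' -> h u = v by rewrite in_setD1 => /andP [_ /Sv].
have hl := Sv _ lS.
have lm : l != m by apply: contraNneq mS => <-.
have IHm : sub1 V (image (pr1 (marked h T X S') m) G).
  by apply: IH => //; rewrite in_setD1 negb_and mS orbT.
have IHl : sub1 V (image (pr1 (marked h T X S') l) G).
  by apply: IH => //; rewrite in_setD1 eqxx.
have aM : adm h (marked h T X S') by exact: adm_marked.
pose T1 := pr1 (marked h T X S') l.
have aT1 : adm1 v T1 by rewrite -hl; exact: adm_pr1.
have T1V : sub1 T1 V by move=> z x [a [[Ta _] <-]]; exact: TV.
have XT1 : inhab (meet1 X T1) by exact: meetX.
pose P0 := pr2 (marked h T X S') l m.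
have aP0 : adm2 v v P0 by have := adm_pr2 lm aM; rewrite hl hm.
pose P := comp P0 G.
have aP : adm2 v v P by exact: adm_comp aP0 aG.
have PT1 z x y : P z id x y -> T1 z id x /\ V z id y.
  by move=> [t [[a [ma al am]] /GV [_ Vy]]]; split=> //; exists a.
have T1P z x : T1 z id x -> exists y, P z id x y.
  move=> [a [ma al]]; have [y Gy] := Gt _ _ (TV z m a hm (proj1 ma)).
  by exists y, (a m); split=> //; exists a.
have PV : sub1 V (image T1 P).
  move=> z y /IHm [x [[a [ma am]] Gxy]]; exists (a l); split; first by exists a.
  by exists x; split=> //; exists a.
pose X' := image (pr1 (marked h T X S) m) G.
have XP : eq1 (image (meet1 X T1) P) X'.
  move=> z y; split=> [[x [[Xx _] [t [[a [ma al am]] Gty]]]]|[x [[a [ma am]] Gxy]]].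
    exists t; split=> //; exists a; split=> //; apply: (marked_add ma).
    by rewrite al.
  have [Ta Xa] := ma; have ma' := markedD1 l ma.
  exists (a l); split; first by split; [apply: Xa; rewrite lS hl eqxx|exists a].
  by exists x; split=> //; exists a.
have aX' : adm1 v X'.
  by apply: adm_image aG; rewrite -hm; apply: adm_pr1; exact: adm_marked.
have X'0 : inhab X'.
  move=> z; have [x [Xx T1x]] := XT1 z; have [y Pxy] := T1P _ _ T1x.
  by exists y; apply/XP; exists x.
have X'V : sub1 X' V by move=> z y [x [_ /GV []]].
have gP : good P by exact: good_comp_r.
(* [X'] is the image of the pair [T1], [meet1 X T1] under the good relation [P], hence one step
   deeper than [X]. A set [Zs] is tested against [X'] by pulling it back through [P] and testing it
   against [X]. *)
apply: (deeper (X' := X') (G' := comp (inv P) G)).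
  split=> //.
  - exact: adm_comp (adm_inv aP) aG.
  - split=> [z x y [t [/PT1 [_ Vx] /GV [_ Vy]]]|z x Vx|z y Vy] //.
    + have [t [T1t Ptx]] := PV _ _ Vx; have [y Gty] := Gt _ _ (T1V _ _ T1t).
      by exists y, t.
    + have [t [T1t Gty]] := IHl _ _ Vy; have [x Ptx] := T1P _ _ T1t.
      by exists x, t.
  - by apply: good_comp_r => //; exact: adm_inv.
  - move=> Zs aZs ZsV VZ.
    suff mX : inhab (meet1 X (image Zs (inv P))).
      move=> z; have [x [Xx [y [Zy Pxy]]]] := mX z; exists y; split=> //.
      by apply/XP; exists x; split=> //; split=> //; have [] := PT1 _ _ _ Pxy.
    apply: meetX; first exact: adm_image aZs (adm_inv aP).
      by move=> z x [y [_ /PT1 [/T1V]]].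
    move=> z y /VZ [x [Zx [t [Ptx Gty]]]]; exists t; split=> //; by exists x.
split; first by split.
exists T1, (meet1 X T1); split; first exact: depth_restrict depthX _ _ _.
exists P; split=> //; split=> // z y.
by split=> [[x [_ /PT1 []]]|/PV].
Qed.

(** Any mark can be added last: the values left at [l] by the other marks cover [V] through [G], so
    the last clause of [mark] makes them meet [X]. *)
Lemma marks_satisfiable z :
  exists a, T z id a /\ forall w, h w = v -> X z id (a w).
Proof.
have [[aX XV] aG sG gG meetX] := markXG.
have [aT T0 Tx TV] := treeT.
suff /(_ [set w | h w == v]) [] : forall S : {set W}, (forall l, l \in S -> h l = v) ->
    exists a, marked h T X S z id a.
- by move=> l; rewrite inE => /eqP.
- move=> a [Ta Xa]; exists a; split=> // w hw; apply: Xa.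
  by rewrite inE hw eqxx.
move=> S Sv; have [S0|[l lS]] := set_0Vmem S.
  by have [a Ta] := T0 z; exists a; split=> // u; rewrite S0 inE.
have hl := Sv _ lS.
have [|||x [Xx [a [ma al]]]] := meetX (pr1 (marked h T X (S :\ l)) l) _ _ _ z.
- by rewrite -hl; apply: adm_pr1; exact: adm_marked.
- by move=> z1 x [a [[Ta _] <-]]; exact: TV.
- apply: marks_invisible => //; last by rewrite in_setD1 eqxx.
  by move=> u; rewrite in_setD1 => /andP [_ /Sv].
- by exists a; apply: (marked_add ma); rewrite al.
Qed.

End Propagation.

(** A proper mark of depth [n] forces one of depth [n.+1]: otherwise [deeper] would hold and all
    vertices of the tree from [minV] could be marked. Proper marks being live, this exceeds the
    bound on depth. *)
Lemma mark_full X G : mark X G -> sub1 V X.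
Proof.
have inhX Y H : mark Y H -> inhab Y.
  move=> [_ _ [HV Ht Hs] _ mY] z; have [||//|x [Yx _]] := mY V _ _ _ z => //.
    move=> z1 y /Hs [x Hxy]; exists x; split=> //; by have [] := HV _ _ _ Hxy.
  by exists x.
move=> mXG; apply: contrapT => nVX.
suff /(_ depth_bound) [Y [H [mY nY dY]]] : forall n, exists Y H,
    [/\ mark Y H, ~ sub1 V Y & depth n V Y].
  have [[aY YV] _ _ _ _] := mY.
  by have := depth_bounded dY (proper_live aY (inhX _ _ mY) YV nY); rewrite ltnn.
elim=> [|n [Y [H [mY nY dY]]]].
  exists X, G; split=> //; have [[aX XV] _ _ _ _] := mXG.
  by split=> //; split=> //; exact: inhX mXG.
apply: contrapT => nex.
have [[aY YV] _ _ _ _] := mY.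
have [W [h [T [tT [z0 Hz]]]]] := minV aY (inhX _ _ mY) YV nY.
have deeper Y' H' : mark Y' H' -> depth n.+1 V Y' -> sub1 V Y'.
  by move=> mY' dY'; apply: contrapT => nY'; apply: nex; exists Y', H'.
by have [a [Ta Ya]] := marks_satisfiable mY dY deeper tT z0; exact: (Hz a).
Qed.

(** * Preorders between a relation and its constant level *)

Hypothesis adm_reached : adm1 v (fun z _ x => reached v z x).

Notation prel := (Z -> A -> A -> Prop).

Lemma walk_cat Q m m' z x y t :
  walk Q m z x y -> walk Q m' z y t -> walk Q (m + m') z x t.
Proof.
by elim: m x => [|m IH] x /= => [->|[u e w] w'] //; exists u => //; exact: IH.
Qed.

Lemma walk_reached Q m z x y : walk Q m z x y -> reached v z x -> reached v z y.
Proof. by elim: m x => [|m IH] x /= => [->|[t [_ rt _] /IH h]] // _; exact: h. Qed.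

Lemma walk_edge_power Q m z al x y :
  walk Q m.+1 z x y <-> power (fun z _ => edge Q z) m z al x y.
Proof.
elim: m x => [|m IH] x.
  by split=> [[t e <-]|e] //; exists y.
by split=> [[t e /IH w]|[t [e /IH w]]]; exists t.
Qed.

Lemma adm_edge Q : adm2 v v Q -> adm2 v v (fun z _ x y => edge Q z x y).
Proof.
move=> aQ; apply: (adm_iff (P := fun z al (e : bool -> A) => reached v z (e false) /\
    (reached v z (e true) /\ forall c, Q z (fun=> c) (e false) (e true)))).
  by move=> z al e; split=> [[? []]|[? ?]].
apply: adm_and.
  by apply: (adm1_at (i := false) (U := fun z _ x => reached v z x)).
apply: adm_and; last exact: adm_const aQ.
by apply: (adm1_at (i := true) (U := fun z _ x => reached v z x)).
Qed.

Lemma smooth_power Q m : smooth Q -> smooth (power Q m).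
Proof.
move=> [QV Qt Qs]; elim: m => [|m [PV Pt Ps]] //=; split.
- by move=> z x y [t [/QV [Vx _] /PV [_ Vy]]].
- move=> z x /Qt [t Qxt]; have [_ /Pt [y Pty]] := QV _ _ _ Qxt; by exists y, t.
- move=> z y /Ps [t Pty]; have [/Qs [x Qxt] _] := PV _ _ _ Pty; by exists x, t.
Qed.

Lemma max_nat_exists (T : Type) (P : T -> Prop) (f : T -> nat) (M : nat) :
  (forall t, f t <= M) -> (exists t, P t) ->
  exists t, P t /\ forall u, P u -> f u <= f t.
Proof.
move=> fM [t0 Pt0]; have [k] := ubnP (M - f t0).
elim: k t0 Pt0 => // k IH t Pt ltk.
case: (lem (exists u, P u /\ f t < f u)) => [[u [Pu lt]]|nu].
  apply: (IH u Pu); rewrite -ltnS; apply: leq_ltn_trans ltk.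
  by rewrite ltn_sub2l // (leq_trans lt (fM u)).
exists t; split=> // u Pu; rewrite leqNgt; apply/negP => lt; apply: nu; by exists u.
Qed.

Definition good_rel (F : prel) : Prop := forall U : fam1,
  adm1 v U -> inhab U -> sub1 U V ->
  forall z y, V z id y -> exists x, U z id x /\ F z x y.

(** The two inclusions serve opposite purposes: imposing [Q] at [id] guarantees [F], and [F]
    guarantees [Q] at constant [al]. *)
Definition preorder_of (Q : fam2) (F : prel) : Prop :=
  [/\ adm2 v v Q /\ smooth Q, adm2 v v (fun z _ x y => F z x y),
      forall z x y t, F z x y -> F z y t -> F z x t,
      forall z x, reached v z x -> F z x x &
      (forall z x y, Q z id x y -> F z x y) /\
      (forall z x y, F z x y -> edge Q z x y)].

(** [F] is reachability by edges. Because of the loops one length [m.+1] serves all pairs, which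
    makes [F] definable; [Q'] is the composition of [m.+1] copies of [Q]. *)
Lemma walk_preorder Q : adm2 v v Q -> smooth Q ->
  exists Q' F, [/\ preorder_of Q' F, forall z x y, edge Q z x y -> F z x y &
    good_rel F -> good Q].
Proof.
move=> aQ sQ; have [QV Qt Qs] := sQ.
have [m Hm] : exists m, forall p : Z * A * A, (reached v p.1.1 p.1.2 /\
    exists d, walk Q d p.1.1 p.1.2 p.2) -> walk Q m.+1 p.1.1 p.1.2 p.2.
  apply: (@uniform_bound _ (fun p m => (reached v p.1.1 p.1.2 /\
    exists d, walk Q d p.1.1 p.1.2 p.2) -> walk Q m.+1 p.1.1 p.1.2 p.2)) => -[[z x] y].
  case: (lem (exists d, walk Q d z x y)) => [[d w]|nw]; last by exists 0 => m' _ [_ /nw].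
  by exists d => m' dm' [rx _]; apply: (walk_pad aQ rx _ w); exact: leqW.
exists (power Q m), (fun z x y => walk Q m.+1 z x y); split.
- split.
  + by split; [exact: adm_power|exact: smooth_power].
  + apply: (adm_iff _ (adm_power m (adm_edge aQ))) => z al e; split=> /walk_edge_power; exact.
  + move=> z x y t w w'; apply: (Hm (z, x, t)); split; first by have [? []] := w.
    by exists (m.+1 + m.+1); exact: walk_cat w w'.
  + by move=> z x rx; apply: (Hm (z, x, x)); split=> //; exists 0.
  + split=> z x y; last first.
      move=> w; have rx : reached v z x by have [? []] := w.
      split=> //; [exact: walk_reached w rx|exact: walk_power].
    elim: (m) x => [|m' IH] x; first move=> Qxy.
      have [/V_reached rx /V_reached ry] := QV _ _ _ Qxy; exists y => //.
      by split=> //; exact: const_of_id.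
    move=> [t [Qxt w]]; have [/V_reached rx /V_reached rt] := QV _ _ _ Qxt.
    by exists t; [split=> //; exact: const_of_id|exact: IH].
- move=> z x y e; apply: (Hm (z, x, y)); split; first by have [] := e.
  by exists 1, y.
- move=> gF U aU U0 UV z y Vy; have [x [Ux w]] := gF U aU U0 UV z y Vy.
  by exists m.+1, x.
Qed.

(* If some smooth relation is not good, take one whose preorder F is largest:
   every larger one is good, and this is enough to attach all the vertices of a
   tree to one root x by edges below F, hence to confine the tree to the F-closure
   of a set. *)
Section MaximalPreorder.

Variables (om : fam2) (F : prel).
Hypothesis preF : preorder_of om F.
Hypothesis maxF : forall Q : fam2, adm2 v v Q -> smooth Q ->
  (forall z x y, F z x y -> edge Q z x y) ->
  (exists z x y, edge Q z x y /\ ~ F z x y) -> good Q.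
Variables (W : finType) (h : W -> Var) (T : Z -> (A -> A) -> (W -> A) -> Prop).
Hypothesis treeT : tree_like h T.

Definition lab (o : option W) : Var := if o is Some w then h w else v.

Definition linked (J : {set W}) : Z -> (A -> A) -> (option W -> A) -> Prop :=
  fun z al a => (T z al (fun w => a (Some w)) /\ V z al (a None)) /\
    forall j, (j \in J) && (h j == v) -> om z al (a None) (a (Some j)).

(** An interpolant free of [al]: it contains [linked] at [id] and is contained in [linked] at every
    constant [al]. *)
Definition linked_const (J : {set W}) (z : Z) (a : option W -> A) : Prop :=
  [/\ forall c, T z (fun=> c) (fun w => a (Some w)),
      forall o, lab o = v -> reached v z (a o) &
      forall j, (j \in J) && (h j == v) -> F z (a None) (a (Some j))].

Lemma adm_linked J : adm lab (linked J).
Proof.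
have [aT _ _ _] := treeT; have [[aom _] _ _ _ _] := preF.
apply: adm_and; first apply: adm_and.
- exact: (adm_sub (g := Some)) aT.
- exact: (adm1_at (i := None)).
- apply: adm_forall_fin => j; apply: adm_imp => /andP [_ /eqP hj].
  by apply: (adm2_at (i := None) (j := Some j)); rewrite /= hj.
Qed.

Lemma linked_const_level J z a c : linked_const J z a -> linked J z (fun=> c) a.
Proof.
move=> [Ta ra Fa]; have [_ _ _ _ [_ Fom]] := preF; split; first split=> //.
  by have [f Sf <-] := ra None erefl; exact: (adm_sol c admV Sf).
by move=> j jJ; have [_ _] := Fom _ _ _ (Fa j jJ); exact.
Qed.

Lemma linked_id_const J z a : linked J z id a -> linked_const J z a.
Proof.
move=> [[Ta Va] oma]; have [aT _ _ TV] := treeT; have [_ _ _ _ [omF _]] := preF.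
split=> [c|[w|] //= hw|j jJ].
- exact: adm_mono aT Ta.
- by apply: V_reached; apply: (TV z w (fun w => a (Some w))).
- exact: V_reached.
- exact/omF/oma.
Qed.

Lemma linked_const_sol J z f p : Sol z f -> F z p (f v) ->
  linked_const J z (fun o => if o is Some w then f (h w) else p).
Proof.
move=> Sf Fp; have [aT _ _ _] := treeT; have [_ _ _ _ [_ Fom]] := preF.
split=> [c|[w|] /= hw|j /andP [_ /eqP ->]] //.
- exact: (adm_sol c aT Sf).
- by exists f; rewrite ?hw.
- by have [] := Fom _ _ _ Fp.
Qed.

Definition all_onto (J : {set W}) : Prop :=
  forall o z x, lab o = v -> V z id x -> exists a, linked J z id a /\ a o = x.

Lemma linkedV J o z a : lab o = v -> linked J z id a -> V z id (a o).
Proof.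
have [_ _ _ TV] := treeT; case: o => [w|] /= hw [[Ta Va] _] //.
exact: (TV z w (fun w => a (Some w))).
Qed.

Lemma linkedU1 J j z a : linked J z id a -> om z id (a None) (a (Some j)) ->
  linked (j |: J) z id a.
Proof.
move=> [Ta oma] omj; split=> // u /andP [uJ hu]; move: uJ.
by rewrite in_setU1 => /predU1P [->|uJ] //; apply: oma; rewrite uJ hu.
Qed.

Section Link.

Variables (J : {set W}) (j : W).
Hypothesis hj : h j = v.
Hypothesis ontoJ : all_onto J.

Lemma adm_link_proj o1 o2 : lab o1 = v -> lab o2 = v -> o1 != o2 ->
  forall P, adm lab P -> adm2 v v (pr2 P o1 o2).
Proof. by move=> h1 h2 ne P aP; have := adm_pr2 ne aP; rewrite h1 h2. Qed.

Lemma adm_restrict o (Zs : fam1) : lab o = v -> adm1 v Zs ->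
  adm lab (fun z al a => linked J z al a /\ Zs z al (a o)).
Proof.
move=> ho aZ; apply: adm_and; first exact: adm_linked.
by apply: adm1_at; rewrite ho.
Qed.

(* The new link can be cut at [None] or at [Some j]; a coordinate o keeps all
   its values as soon as o is well connected to the free end of the cut. *)
Lemma mark_cut_root o : lab o = v -> o != Some j ->
  good (comp (pr2 (linked J) o (Some j)) (inv om)) ->
  forall z x, V z id x -> exists a, linked (j |: J) z id a /\ a o = x.
Proof.
move=> ho oj gG z x; have [[aom [omV omt oms]] _ _ _ _] := preF.
apply: (@mark_full (pr1 (linked (j |: J)) o)
  (comp (pr2 (linked J) o (Some j)) (inv om))); split=> //.
- split; first by have := adm_pr1 o (adm_linked (j |: J)); rewrite ho.
  by move=> z1 x1 [a [la <-]]; exact: linkedV la.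
- by apply: adm_comp (adm_inv aom); apply: adm_link_proj => //; exact: adm_linked.
- split.
  + move=> z1 x1 y1 [t [[a [la <- at_]] /omV [Vy _]]]; split=> //; exact: linkedV la.
  + move=> z1 x1 /(ontoJ ho) [a [la ao]].
    have [y omy] := oms _ _ (linkedV (o := Some j) hj la).
    by exists y, (a (Some j)); split=> //; exists a.
  + move=> z1 y1 /omt [t omy]; have [_ Vt] := omV _ _ _ omy.
    have [a [la at_]] := ontoJ (o := Some j) hj Vt.
    by exists (a o), t; split=> //; exists a.
- move=> Zs aZ ZV VZ.
  pose Q := comp (pr2 (fun z al a => linked J z al a /\ Zs z al (a o)) None (Some j)) (inv om).
  suff loops : forall z, exists x, Q z id x x.
    move=> z1; have [x1 [t [[a [[la Za] aN at_]] omt1]]] := loops z1; exists (a o); split=> //.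
    by exists a; split=> //; apply: linkedU1 => //; rewrite at_ aN.
  apply: loop_of_total.
  + by apply: adm_comp (adm_inv aom); apply: adm_link_proj => //; exact: adm_restrict.
  + move=> z1 x1 y1 [t [[a [[la _] <- _]] /omV [Vy _]]]; split=> //.
    exact: (linkedV (o := None)) la.
  + move=> z1 y1 /VZ [x1 [Zx [t [[a [la ao at_]] omt1]]]].
    by exists (a None), t; split=> //; exists a; split=> //; rewrite ao.
Qed.

Lemma mark_cut_leaf o : lab o = v -> o != None ->
  good (comp (pr2 (linked J) o None) om) ->
  forall z x, V z id x -> exists a, linked (j |: J) z id a /\ a o = x.
Proof.
move=> ho oN gG z x; have [[aom [omV omt oms]] _ _ _ _] := preF.
apply: (@mark_full (pr1 (linked (j |: J)) o)
  (comp (pr2 (linked J) o None) om)); split=> //.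
- split; first by have := adm_pr1 o (adm_linked (j |: J)); rewrite ho.
  by move=> z1 x1 [a [la <-]]; exact: linkedV la.
- by apply: adm_comp aom; apply: adm_link_proj => //; exact: adm_linked.
- split.
  + move=> z1 x1 y1 [t [[a [la <- at_]] /omV [_ Vy]]]; split=> //; exact: linkedV la.
  + move=> z1 x1 /(ontoJ ho) [a [la ao]].
    have [y omy] := omt _ _ (linkedV (o := None) erefl la).
    by exists y, (a None); split=> //; exists a.
  + move=> z1 y1 /oms [t omy]; have [Vt _] := omV _ _ _ omy.
    have [a [la at_]] := ontoJ (o := None) erefl Vt.
    by exists (a o), t; split=> //; exists a.
- move=> Zs aZ ZV VZ.
  pose Q := comp (pr2 (fun z al a => linked J z al a /\ Zs z al (a o)) (Some j) None) om.
  suff loops : forall z, exists x, Q z id x x.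
    move=> z1; have [x1 [t [[a [[la Za] aj at_]] omt1]]] := loops z1; exists (a o); split=> //.
    by exists a; split=> //; apply: linkedU1 => //; rewrite at_ aj.
  apply: loop_of_total.
  + by apply: adm_comp aom; apply: adm_link_proj => //; exact: adm_restrict.
  + move=> z1 x1 y1 [t [[a [[la _] <- _]] /omV [_ Vy]]]; split=> //.
    exact: (linkedV (o := Some j)) la.
  + move=> z1 y1 /VZ [x1 [Zx [t [[a [la ao at_]] omt1]]]].
    by exists (a (Some j)), t; split=> //; exists a; split=> //; rewrite ao.
Qed.

Variables (z1 : Z) (a1 : option W -> A).
Hypothesis la1 : linked_const J z1 a1.
Hypothesis unsafe : ~ F z1 (a1 None) (a1 (Some j)).

(** The failure of [F] at [a1] makes the edges of the relation from the root to the free end of the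
    cut strictly larger than [F]; by [maxF] that relation is good, which settles the root. *)
Lemma all_onto_link : all_onto (j |: J).
Proof.
have [[aom [omV omt oms]] _ Ftr Frefl [omF Fom]] := preF.
have [Ta1 ra1 Fa1] := la1.
have om_refl z x : reached v z x -> const_level om z x x by exact: const_refl.
have proj_const o1 o2 z a : linked_const J z a ->
    const_level (pr2 (linked J) o1 o2) z (a o1) (a o2).
  by move=> la c; exists a; split=> //; exact: linked_const_level.
have root_good : good (comp (pr2 (linked J) None (Some j)) (inv om)).
  apply: maxF.
  - by apply: adm_comp (adm_inv aom); apply: adm_link_proj => //; exact: adm_linked.
  - split.
    + move=> z x1 y1 [t [[a [la <- at_]] /omV [Vy _]]]; split=> //.
      exact: (linkedV (o := None)) la.
    + move=> z x1 /(ontoJ (o := None) erefl) [a [la ao]].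
      have [y omy] := oms _ _ (linkedV (o := Some j) hj la).
      by exists y, (a (Some j)); split=> //; exists a.
    + move=> z y1 /omt [t omy]; have [_ Vt] := omV _ _ _ omy.
      have [a [la at_]] := ontoJ (o := Some j) hj Vt.
      by exists (a None), t; split=> //; exists a.
  - move=> z p q Fpq; have [rp rq _] := Fom _ _ _ Fpq; split=> // c.
    have [f Sf fq] := rq; rewrite -fq in Fpq.
    exists q; split; last exact: om_refl.
    by have := proj_const None (Some j) z _ (linked_const_sol J Sf Fpq) c; rewrite /= hj fq.
  - exists z1, (a1 None), (a1 (Some j)); split=> //; split; [exact: ra1|exact: (ra1 (Some j))|].
    move=> c; exists (a1 (Some j)); split; first exact: proj_const.
    by apply: om_refl; exact: (ra1 (Some j)).
move=> [k|] z x hk; last exact: mark_cut_root.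
(* If some edge from [k] through the root lies outside [F], maximality makes the relation from [k]
   to the root good, and the link is cut at the leaf. *)
case: (lem (exists z2 x2 y2,
    edge (comp (pr2 (linked J) (Some k) None) om) z2 x2 y2 /\ ~ F z2 x2 y2)) => [bad|nbad].
  apply: mark_cut_leaf => //; apply: maxF => //.
  - by apply: adm_comp aom; apply: adm_link_proj => //; exact: adm_linked.
  - split.
    + move=> z2 x1 y1 [t [[a [la <- at_]] /omV [_ Vy]]]; split=> //; exact: linkedV la.
    + move=> z2 x1 /(ontoJ hk) [a [la ao]].
      have [y omy] := omt _ _ (linkedV (o := None) erefl la).
      by exists y, (a None); split=> //; exists a.
    + move=> z2 y1 /oms [t omy]; have [Vt _] := omV _ _ _ omy.
      have [a [la at_]] := ontoJ (o := None) erefl Vt.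
      by exists (a (Some k)), t; split=> //; exists a.
  - move=> z2 p q Fpq; have [rp rq omc] := Fom _ _ _ Fpq; split=> // c.
    have [f Sf fp] := rp; exists p; split; last exact: omc.
    have Fpp : F z2 p (f v) by rewrite fp; exact: Frefl.
    by have := proj_const (Some k) None z2 _ (linked_const_sol J Sf Fpp) c;
      rewrite /= in hk *; rewrite hk fp.
(* Otherwise [F] always leads from [k] back to the root. Applied to a solution through the second
   end of a pair in [F], this shows that [F] is symmetric; then [k] is as well connected to [j] as
   the root is. *)
have back z2 a : linked_const J z2 a -> F z2 (a (Some k)) (a None).
  move=> la; apply: contrapT => nF; apply: nbad.
  have [_ ra _] := la.
  exists z2, (a (Some k)), (a None); split=> //; split; [exact: ra|exact: ra|].
  by move=> c; exists (a None); split; [exact: proj_const|apply: om_refl; exact: ra].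
have Fsym z2 p q : F z2 p q -> F z2 q p.
  move=> Fpq; have [rp [f Sf fq] omc] := Fom _ _ _ Fpq; rewrite -fq in Fpq.
  by have := back z2 _ (linked_const_sol J Sf Fpq); rewrite /= in hk *; rewrite hk fq.
have kj : Some k != Some j.
  by apply: contra_notN unsafe => /eqP <-; apply: Fsym; exact: back.
apply: mark_cut_root => //; apply: maxF.
- by apply: adm_comp (adm_inv aom); apply: adm_link_proj => //; exact: adm_linked.
- split.
  + move=> z2 x1 y1 [t [[a [la <- at_]] /omV [Vy _]]]; split=> //; exact: linkedV la.
  + move=> z2 x1 /(ontoJ hk) [a [la ao]].
    have [y omy] := oms _ _ (linkedV (o := Some j) hj la).
    by exists y, (a (Some j)); split=> //; exists a.
  + move=> z2 y1 /omt [t omy]; have [_ Vt] := omV _ _ _ omy.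
    have [a [la at_]] := ontoJ (o := Some j) hj Vt.
    by exists (a (Some k)), t; split=> //; exists a.
- move=> z2 p q Fpq; have [rp rq _] := Fom _ _ _ Fpq; split=> // c.
  have [_ _ omc] := Fom _ _ _ (Fsym _ _ _ Fpq).
  have [f Sf fp] := rp; exists p; split; last exact: omc.
  have Fpp : F z2 p (f v) by rewrite fp; exact: Frefl.
  by have := proj_const (Some k) (Some j) z2 _ (linked_const_sol J Sf Fpp) c;
    rewrite /= in hk *; rewrite hk hj fp.
- exists z1, (a1 (Some k)), (a1 (Some j)); split.
    split; [exact: ra1|exact: (ra1 (Some j))|] => c.
    exists (a1 (Some j)); split; first exact: proj_const.
    by apply: om_refl; exact: (ra1 (Some j)).
  by move=> Fkj; apply: unsafe; apply: Ftr Fkj; apply: Fsym; exact: back.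
Qed.

End Link.

(** Links are added at vertices where [F] from the root can fail, until there is none. The root
    still takes every value of [V], in particular [u]. *)
Lemma linked_up z u : V z id u ->
  exists a, T z id a /\ forall w, h w = v -> F z u (a w).
Proof.
move=> Vu; have [aT T0 Tx TV] := treeT; have [_ _ _ _ [omF _]] := preF.
have [J [ontoJ safe]] : exists J, all_onto J /\ forall j z a, h j = v ->
    linked_const J z a -> F z (a None) (a (Some j)).
  have onto0 : all_onto set0.
    move=> [w|] z1 x /= hw Vx.
      have [a [Ta aw]] := Tx _ _ _ hw Vx.
      by exists (fun o => if o is Some w then a w else x); split=> //; split=> // j; rewrite inE.
    have [a Ta] := T0 z1.
    by exists (fun o => if o is Some w then a w else x); split=> //; split=> // j; rewrite inE.
  move: onto0; have [k] := ubnP #|~: (set0 : {set W})|.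
  elim: k (set0 : {set W}) => // k IH J ltk ontoJ.
  case: (lem (exists j z a, [/\ h j = v, linked_const J z a & ~ F z (a None) (a (Some j))])).
    move=> [j [z1 [a [hj la nF]]]]; apply: (IH (j |: J)); last exact: all_onto_link la nF.
    rewrite -ltnS; apply: leq_ltn_trans ltk; apply: proper_card.
    rewrite properC properE subsetUr /=.
    apply/subsetPn; exists j; first by rewrite setU11.
    by apply/negP => jJ; apply: nF; have [_ _] := la; apply; rewrite jJ hj eqxx.
  move=> nex; exists J; split=> // j z1 a hj la; apply: contrapT => nF; apply: nex.
  by exists j, z1, a.
have [a [la aN]] := ontoJ None z u erefl Vu.
exists (fun w => a (Some w)); split; first by have [[]] := la.
by move=> w hw; rewrite -aN; apply: safe => //; exact: linked_id_const.
Qed.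

End MaximalPreorder.

(** A smooth relation that is not good yields a preorder that is not good; take the largest such
    [F]. If [F] does not lead from [U] to [y], the part of [V] above [U] is proper, yet [linked_up]
    solves the tree from [minV] inside it. *)
Lemma smooth_good Q : adm2 v v Q -> smooth Q -> good Q.
Proof.
move=> aQ sQ; apply: contrapT => nQ.
pose code2 (F : prel) : {set Z * A * A} := [set p | `[< F p.1.1 p.1.2 p.2 >]].
pose bad (p : fam2 * prel) := preorder_of p.1 p.2 /\ ~ good_rel p.2.
have [|[om F] [[preF nF] maxF]] :=
    @max_nat_exists _ bad (fun p => #|code2 p.2|) #|{: Z * A * A}| (fun p => max_card _).
  have [Q' [F [pre _ gF]]] := walk_preorder aQ sQ.
  by exists (Q', F); split=> // /gF.
apply: nF => U aU U0 UV z y Vy; apply: contrapT => nUy.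
have [_ aF _ Frefl [_ Fom]] := preF.
pose X : fam1 := meet1 V (image U (fun z _ => F z)).
have aX : adm1 v X by apply: adm_meet1 => //; exact: adm_image aU aF.
have [||W [h [T [tT [z0 Hz]]]]] := minV aX _ (fun z x => @proj1 _ _).
- move=> z1; have [x Ux] := U0 z1; exists x; split; first exact: UV.
  by exists x; split=> //; apply: Frefl; exact/V_reached/UV.
- by move=> /(_ _ _ Vy) [_ [x [Ux Fxy]]]; apply: nUy; exists x.
have [u Uu] := U0 z0.
have [|a [Ta Fa]] := linked_up preF _ tT (UV _ _ Uu).
  move=> Q1 aQ1 sQ1 FQ1 [z2 [x2 [y2 [e2 nF2]]]].
  have [Q2 [F2 [pre2 Q1F2 gF2]]] := walk_preorder aQ1 sQ1.
  apply: contrapT => ng; have : bad (Q2, F2) by split=> // /gF2.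
  move=> /maxF /=; rewrite leqNgt => /negP; apply; apply: proper_card.
  rewrite properE; apply/andP; split.
    by apply/subsetP => -[[z3 x3] y3]; rewrite !inE => /asboolP /FQ1 /Q1F2 /asboolP.
  apply/subsetPn; exists (z2, x2, y2); rewrite inE /=; first exact/asboolP/Q1F2.
  exact/asboolP.
have [_ _ _ TV] := tT.
apply: (Hz a) => // w hw; split; first exact: TV.
by exists u; split=> //; exact: Fa.
Qed.

(** * Identification of the copies of one variable *)

Section MergeSort.

Variables (W : finType) (h : W -> Var) (T : Z -> (A -> A) -> (W -> A) -> Prop).
Hypothesis treeT : tree_like h T.

Local Notation lab := (lab h).
Implicit Types (S : {set W}) (o : option W).

Definition redirect (S : {set W}) (a : option W -> A) (w : W) : A :=
  if (w \in S) && (h w == v) then a None else a (Some w).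

Definition merged (S : {set W}) : Z -> (A -> A) -> (option W -> A) -> Prop :=
  fun z al a => T z al (redirect S a) /\ V z al (a None).

Definition free (S : {set W}) (o : option W) : bool :=
  if o is Some w then (h w == v) && (w \notin S) else true.

Lemma adm_merged S : adm lab (merged S).
Proof.
have [aT _ _ _] := treeT; apply: adm_and; last exact: (adm1_at (i := None)).
apply: (adm_iff (P := fun z al a =>
    T z al (fun w => a (if (w \in S) && (h w == v) then None else Some w)))).
  move=> z al a; rewrite (_ : redirect S a = fun w =>
    a (if (w \in S) && (h w == v) then None else Some w)) //.
  by apply/funext => w; rewrite /redirect; case: ifP.
apply: (adm_sub (g := fun w => if (w \in S) && (h w == v) then None else Some w)) aT.
by move=> w; case: ifP => // /andP [_ /eqP ->].
Qed.

Lemma free_lab S o : free S o -> lab o = v.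
Proof. by case: o => [w|] //= /andP [/eqP]. Qed.

Lemma mergedV S o z a : free S o -> merged S z id a -> V z id (a o).
Proof.
have [_ _ _ TV] := treeT; case: o => [w|] /= => [/andP [/eqP hw wS]|_] [Ta Va] //.
by have := TV z w _ hw Ta; rewrite /redirect (negbTE wS).
Qed.

Lemma adm_merge_proj S o1 o2 P : free S o1 -> free S o2 -> o1 != o2 ->
  adm lab P -> adm2 v v (pr2 P o1 o2).
Proof.
by move=> /free_lab h1 /free_lab h2 ne aP; have := adm_pr2 ne aP; rewrite h1 h2.
Qed.

Lemma redirectU1 S j a : a None = a (Some j) -> redirect (j |: S) a = redirect S a.
Proof.
move=> e; apply/funext => w; rewrite /redirect in_setU1.
by case: (eqVneq w j) => [->|] //=; case: eqP => //= _; rewrite -e; case: ifP.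
Qed.

Definition merged_onto (S : {set W}) : Prop := forall o z x,
  free S o -> V z id x -> exists a, merged S z id a /\ a o = x.

Lemma smooth_merged S o1 o2 : merged_onto S -> free S o1 -> free S o2 ->
  smooth (pr2 (merged S) o1 o2).
Proof.
move=> onto f1 f2; split=> [z x y [a [ma <- <-]]|z x Vx|z y Vy].
- by split; exact: mergedV ma.
- by have [a [ma ao]] := onto _ _ _ f1 Vx; exists (a o2), a.
- by have [a [ma ao]] := onto _ _ _ f2 Vy; exists (a o1), a.
Qed.

Lemma adm_merge_restrict S o (Zs : fam1) : free S o -> adm1 v Zs ->
  adm lab (fun z al a => merged S z al a /\ Zs z al (a o)).
Proof.
move=> /free_lab ho aZ; apply: adm_and; first exact: adm_merged.
by apply: adm1_at; rewrite ho.
Qed.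

(** The values kept by a free coordinate after the identification form a mark: the connecting
    relation is good because it is smooth, and the last clause follows from [loop_of_total]. So
    [mark_full] applies. *)
Lemma merged_onto_step S j : h j = v -> j \notin S ->
  merged_onto S -> merged_onto (j |: S).
Proof.
move=> hj jS onto.
have fj : free S (Some j) by rewrite /= hj eqxx.
have fN : free S None by [].
have add z a : merged S z id a -> a None = a (Some j) -> merged (j |: S) z id a.
  by move=> [Ta Va] e; split=> //; rewrite redirectU1.
move=> [k|] z x fk; last first.
  pose Q := pr2 (merged S) None (Some j).
  have aQ : adm2 v v Q by apply: (adm_merge_proj fN fj) => //; exact: adm_merged.
  have sQ : smooth Q by exact: smooth_merged.
  (* For the root itself, the mark consists of the loops of [Q]. *)
  move=> /(@mark_full (fun z al x => Q z al x x) Q) [].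
    split=> //; [split|exact: smooth_good|].
    + by apply: (adm_sub (g := fun _ : bool => tt)) aQ => -[].
    + by move=> z1 x1 [a [ma <- _]]; exact: (mergedV fN).
    move=> Zs aZ ZV VZ.
    suff loops : forall z, exists x, Q z id x x /\ Zs z id x by [].
    apply: (loop_of_total (Q := fun z al x y => Q z al x y /\ Zs z al x)).
    + by apply: adm_and => //; apply: (adm1_at (i := false)).
    + by move=> z1 x1 y1 [] ; have [QV _ _] := sQ; move=> /QV.
    + by move=> z1 y1 /VZ [x1 [Zx Qxy]]; exists x1.
  by move=> a [ma aN aj]; exists a; split=> //; apply: add => //; rewrite aN aj.
have fkS : free S (Some k).
  by move: fk; rewrite /= in_setU1 negb_or => /andP [-> /andP [_ ->]].
have kj : Some j != Some k.
  apply/eqP => -[jk]; move: fk; by rewrite -jk /= setU11 andbF.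
pose G := pr2 (merged S) (Some k) None.
have aG : adm2 v v G by apply: (adm_merge_proj fkS fN) => //; exact: adm_merged.
have sG : smooth G by exact: smooth_merged.
apply: (@mark_full (pr1 (merged (j |: S)) (Some k)) G).
split=> //; [split|exact: smooth_good|].
- by have := adm_pr1 (Some k) (adm_merged (j |: S)); rewrite (free_lab fkS).
- by move=> z1 x1 [a [ma <-]]; exact: mergedV ma.
move=> Zs aZ ZV VZ.
pose Q := pr2 (fun z al a => merged S z al a /\ Zs z al (a (Some k))) (Some j) None.
suff loops : forall z, exists x, Q z id x x.
  move=> z1; have [x1 [a [[ma Za] aj aN]]] := loops z1; exists (a (Some k)).
  by split=> //; exists a; split=> //; apply: add => //; rewrite aN aj.
apply: loop_of_total.
- by apply: (adm_merge_proj fj fN) => //; exact: adm_merge_restrict.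
- by move=> z1 x1 y1 [a [[ma _] <- <-]]; split; [exact: (mergedV fj)|exact: (mergedV fN)].
- move=> z1 y1 /VZ [x1 [Zx [a [ma ak aN]]]]; exists (a (Some j)), a.
  by split=> //; split=> //; rewrite ak.
Qed.

Lemma tree_constant z d : V z id d ->
  exists a, T z id a /\ forall w, h w = v -> a w = d.
Proof.
move=> Vd; have [aT T0 Tx TV] := treeT.
have onto0 : merged_onto set0.
  have red0 a : redirect set0 a = fun w => a (Some w).
    by apply/funext => w; rewrite /redirect inE.
  move=> [w|] z1 x /= => [/andP [/eqP hw _]|_] Vx.
    have [a [Ta aw]] := Tx _ _ _ hw Vx.
    by exists (fun o => if o is Some w then a w else x); split=> //; split; rewrite ?red0.
  have [a Ta] := T0 z1.
  by exists (fun o => if o is Some w then a w else x); split=> //; split; rewrite ?red0.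
have [S [onto full]] : exists S, merged_onto S /\ forall w, h w = v -> w \in S.
  move: onto0; have [k] := ubnP #|~: (set0 : {set W})|.
  elim: k (set0 : {set W}) => // k IH S ltk onto.
  case: (lem (exists j, h j = v /\ j \notin S)) => [[j [hj jS]]|nex].
    apply: (IH (j |: S)); last exact: merged_onto_step.
    rewrite -ltnS; apply: leq_ltn_trans ltk; apply: proper_card.
    rewrite properC properE subsetUr /=; apply/subsetPn; exists j => //.
    by rewrite setU11.
  exists S; split=> // w hw; apply: contrapT => /negP wS; apply: nex; by exists w.
have [a [[Ta _] aN]] := onto None z d isT Vd.
exists (redirect S a); split=> // w hw.
by rewrite /redirect full // hw eqxx.
Qed.

End MergeSort.

(** A solution of the tree that is constant on the copies of [v], with a value taken in [B], lies
    inside [B], against [minV]. *)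
Lemma no_proper_subset B : adm1 v B -> inhab B -> sub1 B V -> sub1 V B.
Proof.
move=> aB B0 BV; apply: contrapT => nVB.
have [W [h [T [tT [z0 Hz]]]]] := minV aB B0 BV nVB.
have [d Bd] := B0 z0; have [a [Ta ad]] := tree_constant tT (BV _ _ Bd).
by apply: (Hz a Ta) => w /ad ->.
Qed.

End OneSort.

(** * Trees of constraints and 1-consistency *)

Section UniversalTree.

Variables (A Var Con : finType) (ar : Con -> nat).
Variable sc : forall c, 'I_(ar c) -> Var.

Definition tstep : Type := {c : Con & ('I_(ar c) * 'I_(ar c))%type}.

Definition tmk (c : Con) (i j : 'I_(ar c)) : tstep :=
  Tagged (fun c => ('I_(ar c) * 'I_(ar c))%type) (i, j).

(* A vertex of the universal tree is the list, latest step first, of the steps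
   "enter the constraint c at its i-th variable and leave it at its j-th". *)
Definition tlab (u0 : Var) (p : seq tstep) : Var :=
  if p is s :: _ then sc (tagged s).2 else u0.

Variables (t : nat) (u0 : Var).

(** The scope is [p] at position [i] and the children of [p] elsewhere; [size p < t] keeps the
    children within the length bound, so [insub_bseq] never takes its default value. *)
Definition tree_sat (K : forall c, ('I_(ar c) -> A) -> Prop)
    (a : t.-bseq tstep -> A) : Prop :=
  forall (p : t.-bseq tstep) c (i : 'I_(ar c)), (size p < t) && (tlab u0 p == sc i) ->
    K c (fun j => a (if j == i then p else insub_bseq t (tmk i j :: p))).

Section Extension.

Variables (K : forall c, ('I_(ar c) -> A) -> Prop) (D : Var -> A -> Prop).
Hypothesis D0 : forall u, exists x, D u x.
Hypothesis consD : forall c (i : 'I_(ar c)) x, D (sc i) x ->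
  exists b, [/\ K b, b i = x & forall j, D (sc j) (b j)].

(** [E] chooses the values of the children from the value of the parent. It may depend on the
    vertex, so that the choice can be changed at a single place. *)
Definition selector (E : seq tstep -> tstep -> A -> A) : Prop :=
  forall p c (i : 'I_(ar c)) x,
    (forall j, D (sc j) (E p (tmk i j) x)) /\
    (tlab u0 p = sc i -> D (sc i) x ->
      K (fun j => if j == i then x else E p (tmk i j) x)).

Fixpoint tval (E : seq tstep -> tstep -> A -> A) (x0 : A) (p : seq tstep) : A :=
  if p is s :: p' then E p' s (tval E x0 p') else x0.

Lemma tval_in E x0 p : selector E -> D u0 x0 -> D (tlab u0 p) (tval E x0 p).
Proof.
case: p => [|[c [i j]] p] //= sE _; by have [] := sE p c i (tval E x0 p).
Qed.

Lemma selector_exists : exists E, selector E.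
Proof.
have [F HF] : exists F : tstep -> A -> A, forall c (i : 'I_(ar c)) x,
    (forall j, D (sc j) (F (tmk i j) x)) /\
    (D (sc i) x -> K (fun j => if j == i then x else F (tmk i j) x)).
  have h (q : {c : Con & 'I_(ar c)} * A) : exists b : 'I_(ar (tag q.1)) -> A,
      (forall j, D (sc j) (b j)) /\
      (D (sc (tagged q.1)) q.2 -> K (fun j => if j == tagged q.1 then q.2 else b j)).
    move: q => [[c i] x] /=; case: (lem (D (sc i) x)) => [Dx|nDx].
      have [b [Kb bi Db]] := consD Dx; exists b; split=> // _.
      by rewrite (_ : (fun j => _) = b) //; apply/funext => j; case: eqP => [->|].
    have /choice [b Db] : forall j : 'I_(ar c), exists x, D (sc j) x by move=> j.
    by exists b.
  pose G q := projT1 (cid (h q)); have HG q := projT2 (cid (h q)).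
  exists (fun s x => G (Tagged (fun c => 'I_(ar c)) (tagged s).1, x) (tagged s).2).
  by move=> c i x; exact: (HG (Tagged (fun c => 'I_(ar c)) i, x)).
by exists (fun _ => F) => p c i x; have [h1 h2] := HF c i x.
Qed.

Lemma selector_through p c (i : 'I_(ar c)) x b E : selector E ->
  (tlab u0 p = sc i -> K b /\ b i = x) -> (forall j, D (sc j) (b j)) ->
  exists E', [/\ selector E', forall j, E' p (tmk i j) x = b j &
    forall q s y, q != p -> E' q s y = E q s y].
Proof.
move=> sE Kb Db.
exists (fun q s y => if (q == p) && (y == x) then
    if [pick j | s == tmk i j] is Some j then b j else E q s y
  else E q s y); split.
- move=> q c' i' y /=; case: (boolP ((q == p) && (y == x))); last by move=> _; exact: sE.
  move=> /andP [/eqP -> /eqP ->].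
  case: (eqVneq (Tagged (fun c => 'I_(ar c)) i') (Tagged (fun c => 'I_(ar c)) i)) => [e|ne].
    have ec : c' = c by exact: (congr1 tag e).
    move: i' e; rewrite ec => i' /eqP; rewrite eq_Tagged /= => /eqP -> {ec i'}.
    have pk j : [pick j0 | tmk i j == tmk i j0] = Some j.
      case: pickP => [j0|/(_ j)]; last by rewrite eqxx.
      by rewrite eq_Tagged /= => /eqP [->].
    split=> [j|/Kb [Kb' bi] _]; first by rewrite pk.
    rewrite (_ : (fun j => _) = b) //; apply/funext => j.
    by rewrite pk; case: eqP => [->|].
  have pk j : [pick j0 | tmk i' j == tmk i j0] = None.
    case: pickP => // j0 /eqP e; case/eqP: ne.
    by have := congr1 (fun s : tstep => Tagged (fun c => 'I_(ar c)) (tagged s).1) e.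
  have [sE1 sE2] := sE p c' i' x; split=> [j|lp Dy]; first by rewrite pk.
  rewrite (_ : (fun j => _) = (fun j => if j == i' then x else E p (tmk i' j) x)).
    exact: sE2.
  by apply/funext => j; rewrite pk.
- move=> j; rewrite !eqxx /=; case: pickP => [j0|/(_ j)]; last by rewrite eqxx.
  by rewrite eq_Tagged /= => /eqP [->].
- by move=> q s y /negbTE ->.
Qed.

(** The value [d] is carried up to the root: a tuple supporting it prescribes the value of the
    parent, and the selector is changed at the parent to choose this tuple. *)
Lemma tval_through p d : D (tlab u0 p) d ->
  exists E x0, [/\ selector E, D u0 x0 & tval E x0 p = d].
Proof.
elim: p d => [|[c [i j]] p IH] d Dd.
  by have [E sE] := selector_exists; exists E, d.
have [b [Kb bj Db]] := consD Dd.
have [E [x0 [x [sE Dx0 ex lp]]]] : exists E x0 x, [/\ selector E, D u0 x0,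
    tval E x0 p = x & tlab u0 p = sc i -> b i = x].
  (* The steps of a list need not fit together. Where they do not, no constraint is imposed and any
     value of the parent will do. *)
  case: (eqVneq (tlab u0 p) (sc i)) => [lp|/eqP nlp].
    have /IH [E [x0 [sE Dx0 ex]]] : D (tlab u0 p) (b i) by rewrite lp.
    by exists E, x0, (b i).
  have [x /IH [E [x0 [sE Dx0 ex]]]] := D0 (tlab u0 p).
  by exists E, x0, x.
have [|//|E' [sE' Epb Eq]] := @selector_through p c i x b E sE.
  by move=> /lp.
exists E', x0; split=> //=.
(* Computing the value at [p] consults the selector only at proper suffixes of [p], where [E']
   agrees with [E]. *)
have -> : tval E' x0 p = x.
  rewrite -ex; have : size p <= size p by [].
  elim: {1 3 4}p => [|s q IHq] //= sq; rewrite IHq ?(ltnW sq) // Eq //.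
  by apply: contraTneq sq => ->; rewrite ltnn.
by have := Epb j; rewrite /tmk /Tagged /= => ->.
Qed.

Lemma tree_extends (w : t.-bseq tstep) d : D (tlab u0 w) d ->
  exists a, [/\ tree_sat K a, forall p : t.-bseq tstep, D (tlab u0 p) (a p) & a w = d].
Proof.
move=> /tval_through [E [x0 [sE Dx0 <-]]].
exists (fun p : t.-bseq tstep => tval E x0 p); split=> // [p c i /andP [ltp /eqP lp]|p].
  have [_ sK] := sE p c i (tval E x0 p).
  move: (sK lp); rewrite -lp => /(_ (tval_in p sE Dx0)).
  rewrite (_ : (fun j => _) = (fun j : 'I_(ar c) =>
    tval E x0 (if j == i then p else insub_bseq t (tmk i j :: p)))) //.
  apply/funext => j; case: eqP => // _.
  by rewrite /insub_bseq insubdK.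
exact: tval_in.
Qed.

End Extension.

(** [s] rounds of 1-consistency propagation starting from [M]; each round is definable, whereas an
    unbounded fixed point would not obviously be. *)
Fixpoint refine (K : forall c, ('I_(ar c) -> A) -> Prop) (M : Var -> A -> Prop)
    (s : nat) (u : Var) (x : A) : Prop :=
  if s is s'.+1 then
    refine K M s' u x /\ forall c (i : 'I_(ar c)), sc i == u ->
      exists b : 'I_(ar c) -> A,
        (K c b /\ forall j, refine K M s' (sc j) (b j)) /\ b i = x
  else M u x.

(** A value at [p] survives as many rounds of propagation as there are levels of the tree below
    [p]. *)
Lemma tree_refine K M (a : t.-bseq tstep -> A) (s : nat) (p : t.-bseq tstep) :
  tree_sat K a -> (forall p : t.-bseq tstep, M (tlab u0 p) (a p)) ->
  size p + s <= t -> refine K M s (tlab u0 p) (a p).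
Proof.
move=> Ka Ma; elim: s p => [|s IH] p //= le.
have IHp : refine K M s (tlab u0 p) (a p).
  by apply: IH; apply: leq_trans le; rewrite leq_add2l.
split=> // c i /eqP sci.
have ltp : size p < t by apply: leq_trans le; rewrite addnS ltnS leq_addr.
exists (fun j => a (if j == i then p else insub_bseq t (tmk i j :: p))).
rewrite eqxx; split=> //; split; first by apply: Ka; rewrite ltp sci eqxx.
move=> j; case: eqP => [->|_]; first by rewrite sci.
have sz : size (tmk i j :: p) <= t by [].
have -> : sc j = tlab u0 (insub_bseq t (tmk i j :: p)) by rewrite /insub_bseq insubdK.
by apply: IH; rewrite /insub_bseq insubdK //= addSn -addnS.
Qed.

End UniversalTree.

(** * Solvability of consistent instances with definable constraints *)

Section Solvability.

Variables (A : finType) (N : nat) (R : {set N.-tuple A}).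
Variables (Var Con : finType) (Sol : {ffun A -> A} -> (Var -> A) -> Prop).
Variables (ar : Con -> nat) (sc : forall c, 'I_(ar c) -> Var).

Notation Z := {ffun A -> A}.
Notation fam1 := (Z -> (A -> A) -> A -> Prop).
Notation adm := (adm R Sol).
Notation adm1 := (adm1 R Sol).
Notation adm2 := (adm2 R Sol).

Variable C : forall c, Z -> (A -> A) -> ('I_(ar c) -> A) -> Prop.
Hypothesis ar_gt0 : forall c, 0 < ar c.
Hypothesis admC : forall c, adm (@sc c) (@C c).
Hypothesis adm_reached : forall v, adm1 v (fun z _ x => reached Sol v z x).
Hypothesis ruleV : forall v, no_mightyV R Sol v.
Hypothesis ruleIV : forall v, no_mightyIV R Sol v.

Definition supports (D : Var -> A -> Prop) (z : Z) : Prop :=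
  forall c (i : 'I_(ar c)) x, D (sc i) x ->
    exists b, [/\ C z id b, b i = x & forall j, D (sc j) (b j)].

Definition consistent (D : Var -> fam1) : Prop :=
  [/\ forall u, adm1 u (D u), forall u, inhab (D u),
      forall u z x, D u z id x -> reached Sol u z x &
      forall z, supports (fun u => D u z id) z].

Lemma adm_refine (M : Var -> fam1) s u : (forall u, adm1 u (M u)) ->
  adm1 u (fun z al => refine sc (fun c => @C c z al) (fun u => M u z al) s u).
Proof.
move=> aM; elim: s u => [|s IH] u //=.
apply: adm_and; first exact: IH.
apply: adm_forall_fin => c; apply: adm_forall_fin => i.
apply: adm_imp => /eqP <-.
apply: (adm_pr1 (h := @sc c) (T := fun z al b => C z al b /\
  forall j, refine sc (fun c => @C c z al) (fun u => M u z al) s (sc j) (b j))).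
apply: adm_and => //; apply: adm_forall_fin => j.
apply: (adm1_at (i := j) (U := fun z al =>
  refine sc (fun c => @C c z al) (fun u => M u z al) s (sc j))); exact: IH.
Qed.

Lemma refine_sub K (M : Var -> A -> Prop) s u x : refine sc K M s u x -> M u x.
Proof. by elim: s x => [|s IH] x //= [/IH]. Qed.

Lemma refine_stable (M : Var -> fam1) : exists s, forall z u x,
  refine sc (fun c => @C c z id) (fun u => M u z id) s u x ->
  refine sc (fun c => @C c z id) (fun u => M u z id) s.+1 u x.
Proof.
pose code s : {set Z * Var * A} := [set p |
  `[< refine sc (fun c => @C c p.1.1 id) (fun u => M u p.1.1 id) s p.1.2 p.2 >]].
have [s es] : exists s, code s.+1 = code s.
  apply: finset_stabilizes => s; apply/subsetP => -[[z u] x].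
  by rewrite !inE => /asboolP [h _]; exact/asboolP.
exists s => z u x h; have : (z, u, x) \in code s by rewrite inE; exact/asboolP.
by rewrite -es inE => /asboolP.
Qed.

Lemma refine_consistent (M : Var -> fam1) s z :
  (forall u x, refine sc (fun c => @C c z id) (fun u => M u z id) s u x ->
     refine sc (fun c => @C c z id) (fun u => M u z id) s.+1 u x) ->
  supports (refine sc (fun c => @C c z id) (fun u => M u z id) s) z.
Proof.
move=> st c i x /st [_ /(_ c i (eqxx _)) [b [[Cb Db] bi]]]; by exists b.
Qed.

Section Minimal.

Variable D : Var -> fam1.
Hypothesis consD : consistent D.
Hypothesis minD : forall D', consistent D' -> (forall u, sub1 (D' u) (D u)) ->
  forall u, sub1 (D u) (D' u).

(** Replace [D v] by [X] and propagate until stable. If no domain becomes empty, the result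
    contradicts minimality; if the domain of [u0] does at [z0], the tree of that many levels rooted
    at [u0] has no solution with all copies of [v] in [X]. *)
Lemma minimal_tree v (X : fam1) :
  adm1 v X -> inhab X -> sub1 X (D v) -> ~ sub1 (D v) X ->
  exists (W : finType) (h : W -> Var) T, tree_like R Sol v (D v) h T /\
    exists z, forall a : W -> A, T z id a -> ~ forall w, h w = v -> X z id (a w).
Proof.
move=> aX X0 XD nDX; have [aD D0 rD sD] := consD.
pose M u : fam1 := if u == v then X else D u.
have aM u : adm1 u (M u).
  by rewrite /M; case: eqP => [->|_]; [exact: aX|exact: aD].
have MD u : sub1 (M u) (D u).
  by rewrite /M; case: eqP => [->|_]; [exact: XD|move=> z x].
have [s st] := refine_stable M.
pose D' u : fam1 := fun z al => refine sc (fun c => @C c z al) (fun u => M u z al) s u.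
have [[z0 [u0 empty]]|ne] := lem (exists z u, forall x, ~ D' u z id x); last first.
  case: nDX; have cD' : consistent D'.
    split.
    - by move=> u; exact: adm_refine.
    - by move=> u z; apply: contrapT => nx; apply: ne; exists z, u => x Dx; apply: nx; exists x.
    - by move=> u z x /refine_sub /MD; exact: rD.
    - by move=> z; apply: refine_consistent => u x; exact: st.
  move=> z x Dx; have := minD cD' (fun u z x h => MD u z x (refine_sub h)) Dx.
  by move=> /refine_sub; rewrite /M eqxx.
pose W : finType := s.-bseq (tstep ar).
pose T : Z -> (A -> A) -> (W -> A) -> Prop := fun z al a =>
  tree_sat sc u0 (fun c => @C c z al) a /\
  forall w : s.-bseq (tstep ar), D (tlab sc u0 w) z al (a w).
exists W, (fun w : s.-bseq (tstep ar) => tlab sc u0 w), T; split; first split.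
- apply: adm_and.
    apply: adm_forall_fin => p; apply: adm_forall_fin => c; apply: adm_forall_fin => i.
    apply: adm_imp => /andP [ltp /eqP lp].
    apply: (adm_sub (g := fun j => if j == i then p else insub_bseq s (tmk i j :: p))
      _ (admC c)) => j; case: eqP => [->|_] //.
    by rewrite /insub_bseq insubdK.
  apply: adm_forall_fin => w.
  by apply: (adm1_at (i := w) (U := D (tlab sc u0 w))); exact: aD.
- move=> z; have [x Dx] := D0 u0 z.
  have [a [Ta Da _]] := tree_extends (t := s) (w := [bseq]) (fun u => D0 u z) (sD z) Dx.
  by exists a.
- move=> z w x hw Dx; rewrite -hw in Dx.
  have [a [Ta Da aw]] := tree_extends (fun u => D0 u z) (sD z) Dx.
  by exists a.
- by move=> z w a <- [_ Da].
- exists z0 => a [Ta Da] Xa; apply: (empty (a [bseq])).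
  apply: (tree_refine (p := [bseq]) Ta) => // p.
  by rewrite /M; case: eqP => [/Xa|].
Qed.

Lemma minimal_atom v B : adm1 v B -> inhab B -> sub1 B (D v) -> sub1 (D v) B.
Proof.
have [aD D0 rD sD] := consD.
apply: (no_proper_subset (ruleV (v := v)) (ruleIV (v := v)) (aD v) (D0 v) (rD v)) => //.
by move=> X; exact: minimal_tree.
Qed.

Let W : finType := {c : Con & 'I_(ar c)}.
Let lab (x : Var + W) : Var := match x with inl u => u | inr w => sc (tagged w) end.

(* The copies in S of the variables of the separate constraints are identified
   with the variables themselves. *)
Let glued (S : {set W}) : Z -> (A -> A) -> (Var + W -> A) -> Prop := fun z al e =>
  (forall c, C z al (fun i : 'I_(ar c) =>
     e (if Tagged (fun c => 'I_(ar c)) i \in S then inl (sc i)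
        else inr (Tagged (fun c => 'I_(ar c)) i)))) /\
  forall x, D (lab x) z al (e x).

(** After any number of gluings each coordinate still takes all its values, by [minimal_atom]. The
    relation between a variable and its next copy is therefore subdirect, and a loop in it glues
    that copy. *)
Lemma minimal_solution z : exists g : Var -> A, forall c, C z id (fun i : 'I_(ar c) => g (sc i)).
Proof.
have [aD D0 rD sD] := consD.
have aG S : adm lab (glued S).
  apply: adm_and; last by apply: adm_forall_fin => x;
    apply: (adm1_at (i := x) (U := D (lab x))); exact: aD.
  apply: adm_forall_fin => c.
  apply: (adm_sub (g := fun i => if Tagged (fun c => 'I_(ar c)) i \in S then inl (sc i)
    else inr (Tagged (fun c => 'I_(ar c)) i)) _ (admC c)) => i.
  by case: ifP.
suff /(_ setT z) [e [Ce _]] : forall S z, exists e, glued S z id e.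
  exists (fun u => e (inl u)) => c; have := Ce c.
  rewrite (_ : (fun i => _) = (fun i => e (inl (sc i)))) //.
  by apply/funext => i; rewrite inE.
move=> S; have [k] := ubnP #|S|; elim: k S => // k IH S ltSk.
have [->|[w wS]] := set_0Vmem S.
  (* With nothing glued the constraints share no variables; each has a solution inside [D], as its
     arity is positive. *)
  move=> z1; have Dx u := cid (D0 u z1).
  have hb c : exists b, C z1 id b /\ forall j : 'I_(ar c), D (sc j) z1 id (b j).
    have [x Dxi] := D0 (sc (Ordinal (ar_gt0 c))) z1.
    by have [b [Cb _ Db]] := sD z1 _ _ _ Dxi; exists b.
  exists (fun x => match x with inl u => projT1 (Dx u)
    | inr w => projT1 (cid (hb (tag w))) (tagged w) end); split=> [c|[u|w]] /=.
  - have [Cb _] := projT2 (cid (hb c)); congr (C z1 id _) : Cb.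
    by apply/funext => i; rewrite inE.
  - exact: projT2 (Dx u).
  - by have [_ Db] := projT2 (cid (hb (tag w))).
have {}IH : forall z, exists e, glued (S :\ w) z id e.
  by apply: IH; rewrite (cardsD1 w) wS in ltSk.
pose v : Var := sc (tagged w).
have full x : lab x = v -> forall z y, D v z id y ->
    exists e, glued (S :\ w) z id e /\ e x = y.
  move=> hx; apply: (minimal_atom (B := pr1 (glued (S :\ w)) x)).
  - by rewrite -hx; exact: adm_pr1.
  - by move=> z1; have [e Ge] := IH z1; exists (e x), e.
  - by move=> z1 y [e [[_ De] <-]]; rewrite -hx.
pose Q := pr2 (glued (S :\ w)) (inl v) (inr w).
have loops : forall z, exists x, Q z id x x.
  apply: (loop_of_total (ruleV (v := v)) (aD v) (D0 v) (rD v)).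
  - exact: (adm_pr2 (h := lab) (l := inl v) (m := inr w)).
  - by move=> z1 x y [e [[_ De] <- <-]]; split; [exact: (De (inl v))|exact: (De (inr w))].
  - by move=> z1 y /(full (inr w) erefl) [e [Ge ew]]; exists (e (inl v)), e.
move=> z1; have [x [e [[Ce De] ev ew]]] := loops z1.
exists e; split=> // c; have := Ce c.
rewrite (_ : (fun i => _) = (fun i : 'I_(ar c) =>
  e (if Tagged (fun c => 'I_(ar c)) i \in S then inl (sc i)
        else inr (Tagged (fun c => 'I_(ar c)) i)))) //.
apply/funext => i; rewrite in_setD1; case: eqP => [ei|_] //=.
rewrite ei wS ew -ev /v; congr (e (inl _)).
by rewrite -ei.
Qed.

End Minimal.

Theorem consistent_solvable : (exists D, consistent D) ->
  forall z, exists g : Var -> A, forall c, C z id (fun i : 'I_(ar c) => g (sc i)).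
Proof.
pose code (D : Var -> fam1) : {set Z * Var * A} :=
  [set p | `[< D p.1.2 p.1.1 id p.2 >]].
move=> exD z.
have [D [consD maxD]] := @max_nat_exists _ consistent (fun D => #|~: code D|)
  #|{: Z * Var * A}| (fun D => max_card _) exD.
apply: (minimal_solution consD) => D' cD' D'D u z1 x Dx; apply: contrapT => nDx.
have := maxD _ cD'; rewrite leqNgt => /negP; apply; apply: proper_card.
rewrite properC properE; apply/andP; split.
  by apply/subsetP => -[[z2 u2] x2]; rewrite !inE => /asboolP /D'D /asboolP.
by apply/subsetPn; exists (z1, u, x); rewrite inE; exact/asboolP.
Qed.

End Solvability.

(** * Mighty tuples *)

Section AllQuantifiers.

Variables (A : finType) (N : nat) (R : {set N.-tuple A}).

Lemma qdef_all_ord (I : finType) (m : nat) (P : (I -> A) -> ('I_m -> A) -> Prop) :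
  @qdef A N R (I + 'I_m)%type (fun e => P (fun i => e (inl i)) (fun j => e (inr j))) ->
  qdef R (fun e => forall b, P e b).
Proof.
elim: m I P => [|m IH] I P qP.
  pose g (x : I + 'I_0) : I :=
    match x with inl i => i | inr j => False_rect I (notF (ltn_ord j)) end.
  apply: qdef_iff (qdef_sub g qP) => e; split=> [Pe b|]; last by move=> Pe; exact: Pe.
  by congr (P _ _) : Pe; apply/funext => -[].
pose B (e : I -> A) (x : A) (b : 'I_m -> A) :=
  P e (fun j => if unlift ord0 j is Some j' then b j' else x).
suff: qdef R (fun e => forall x, forall b, B e x b).
  apply: qdef_iff => e; split=> [Bb b|Pb x b]; last exact: Pb.
  have := Bb (b ord0) (fun j => b (lift ord0 j)); congr (P _ _).
  by apply/funext => j; case: unliftP => [j' ->|->].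
apply: qdef_all.
apply: (IH _ (fun e b => B (fun i => e (Some i)) (e None) b)).
pose g (x : I + 'I_m.+1) : option I + 'I_m :=
  match x with
  | inl i => inl (Some i)
  | inr j => if unlift ord0 j is Some j' then inr j' else inl None
  end.
apply: qdef_iff (qdef_sub g qP) => e; rewrite /B /g.
by rewrite (_ : (fun j => _) = (fun j =>
    if unlift ord0 j is Some j' then e (inr j') else e (inl None))) //;
  apply/funext => j; case: unlift.
Qed.

End AllQuantifiers.

Section Rules.

Variables (k n : nat) (R : {set (n.+1 + n).-tuple 'I_k}).
Hypothesis a0 : 'I_k.
Variables (Var : eqType) (Sol : {ffun 'I_k -> 'I_k} -> (Var -> 'I_k) -> Prop) (v : Var).

Notation A := 'I_k.
Notation Z := {ffun A -> A}.
Notation fam1 := (Z -> (A -> A) -> A -> Prop).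
Notation fam2 := (Z -> (A -> A) -> A -> A -> Prop).
Notation adm1 := (adm1 R Sol).
Notation adm2 := (adm2 R Sol).

Definition fun_of (z : k.-tuple A) : Z := [ffun a => tnth z a].

Definition punary_of (U : Z -> A -> Prop) : punary k :=
  [set t | `[< U [ffun a => tnth t (lshift 1 a)] (tnth t (rshift k ord0)) >]].

(** The number of alpha parameters is [k]: alpha is the tuple of values of [al]. *)
Definition pbinary_of (Q : fam2) : pbinary k k :=
  [set t | `[< Q [ffun a => tnth t (lshift 2 (lshift k a))]
                 (fun a => tnth t (lshift 2 (rshift k a)))
                 (tnth t (rshift (k + k) ord0)) (tnth t (rshift (k + k) ord_max)) >]].

Lemma usection_of U z x : (x \in usection (punary_of U) z) = `[< U (fun_of z) x >].
Proof.
rewrite !inE; congr (`[< U _ _ >]).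
  by apply/ffunP => a; rewrite !ffunE tnth_lshift.
by rewrite (tnth_rshift z [tuple x]).
Qed.

Lemma bsection_of Q z al x y :
  ((x, y) \in bsection (pbinary_of Q) z al) = `[< Q (fun_of z) (tnth al) x y >].
Proof.
rewrite !inE /=; congr (`[< Q _ _ _ _ >]).
- by apply/ffunP => a; rewrite !ffunE !tnth_lshift.
- by apply/funext => a; rewrite tnth_lshift tnth_rshift.
- by rewrite (tnth_rshift _ [tuple x; y]).
- by rewrite (tnth_rshift _ [tuple x; y]).
Qed.

Lemma bsection_all_of Q z x y : (forall al, Q (fun_of z) id x y -> Q (fun_of z) al x y) ->
  ((x, y) \in bsection_all (pbinary_of Q) z) = `[< Q (fun_of z) id x y >].
Proof.
move=> mQ; apply/bigcapP/asboolP => [h|Qxy al _]; last first.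
  by rewrite bsection_of; apply/asboolP/mQ.
have := h [tuple a | a < k] isT; rewrite bsection_of => /asboolP.
congr (Q _ _ x y); apply/funext => a; by rewrite tnth_mktuple.
Qed.

Lemma bsection_diag_of Q z x y :
  ((x, y) \in bsection_diag (pbinary_of Q) z) =
  `[< forall c, Q (fun_of z) (fun=> c) x y >].
Proof.
have cst c : tnth (nseq_tuple k c) = (fun=> c) by apply/funext => a; rewrite tnth_nseq.
apply/bigcapP/asboolP => [h c|Qxy c _].
  by have := h c isT; rewrite bsection_of cst => /asboolP.
by rewrite bsection_of cst; exact/asboolP.
Qed.

(** The identity map cannot be named in a formula; by monotonicity its level is the one obtained by
    quantifying universally over all of [al]. *)
Lemma punary_qdef U : adm1 v U -> qdefinable R (punary_of (fun z => U z id)).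
Proof.
move=> aU; apply: qdef_qdefinable => //.
apply: (qdef_iff (P := fun e : 'I_(k + 1) -> A => forall al : 'I_k -> A,
    U [ffun a => e (lshift 1 a)] al (e (rshift k ord0)))).
  move=> e; rewrite inE; set z := [ffun a => _].
  have -> : [ffun a => tnth [tuple e i | i < k + 1] (lshift 1 a)] = z.
    by apply/ffunP => a; rewrite !ffunE tnth_mktuple.
  rewrite tnth_mktuple; split=> [h|/asboolP h al]; first exact/asboolP.
  by have [_ mU _] := aU; exact: (mU z al (fun=> e (rshift k ord0)) h).
apply: (qdef_all_ord (P := fun e al =>
  U [ffun a => e (lshift 1 a)] al (e (rshift k ord0)))).
pose g (x : A + (A + unit)) : 'I_(k + 1) + 'I_k :=
  match x with
  | inl a => inl (lshift 1 a) | inr (inl a) => inr a | inr (inr _) => inl (rshift k ord0)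
  end.
by have [qU _ _] := aU; exact: (qdef_sub g qU).
Qed.

Lemma par_qdef_id (I : finType) (lab : I -> Var) (P : Z -> (A -> A) -> (I -> A) -> Prop) :
  adm R Sol lab P -> par_qdef R (fun z _ e => P z id e).
Proof.
move=> [qP mP _].
apply: (qdef_iff (P := fun e : A + (A + I) -> A => forall al : A -> A,
    P [ffun a => e (inl a)] al (fun i => e (inr (inr i))))).
  by move=> e; split=> [|h al]; [exact|exact: mP].
apply: (qdef_all_ord (P := fun e al =>
  P [ffun a => e (inl a)] al (fun i => e (inr (inr i))))).
pose g (x : A + (A + I)) : (A + (A + I)) + A :=
  match x with
  | inl a => inl (inl a) | inr (inl a) => inr a | inr (inr i) => inl (inr (inr i))
  end.
exact: (qdef_sub g qP).
Qed.

Lemma pbinary_qdef Q :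
  @par_qdef A _ R bool (fun z al e => Q z al (e false) (e true)) ->
  qdefinable R (pbinary_of Q).
Proof.
move=> qQ; apply: qdef_qdefinable => //.
pose g (x : A + (A + bool)) : 'I_(k + k + 2) :=
  match x with
  | inl a => lshift 2 (lshift k a) | inr (inl a) => lshift 2 (rshift k a)
  | inr (inr b) => if b then rshift (k + k) ord_max else rshift (k + k) ord0
  end.
apply: qdef_iff (qdef_sub g qQ) => e; rewrite inE /=.
have -> : [ffun a => e (lshift 2 (lshift k a))] =
    [ffun a => tnth [tuple e i | i < k + k + 2] (lshift 2 (lshift k a))].
  by apply/ffunP => a; rewrite !ffunE tnth_mktuple.
have -> : (fun a => e (lshift 2 (rshift k a))) =
    (fun a => tnth [tuple e i | i < k + k + 2] (lshift 2 (rshift k a))).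
  by apply/funext => a; rewrite tnth_mktuple.
by rewrite !tnth_mktuple; split=> [h|/asboolP]; first exact/asboolP.
Qed.

Definition has_mightyV : Prop := exists (m : nat) (Q : pbinary k m) (D : punary k),
  [/\ 1 <= m, mightyV Q D & qdefinable R Q /\ qdefinable R D].

Definition has_mightyIV : Prop := exists (m : nat) (Q : pbinary k m) (D B C : punary k),
  [/\ 1 <= m, mightyIV Q D B C
    & [/\ qdefinable R Q, qdefinable R D, qdefinable R B & qdefinable R C]].

Lemma k_gt0 : 0 < k.
Proof. exact: leq_ltn_trans (ltn_ord a0). Qed.

Lemma fun_of_surj (z : Z) : exists t, fun_of t = z.
Proof.
by exists [tuple z a | a < k]; apply/ffunP => a; rewrite ffunE tnth_mktuple.
Qed.

Lemma mightyV_rule : ~ has_mightyV -> no_mightyV R Sol v.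
Proof.
move=> nV Q aQ Q0 Qr Qs Qp z0; apply: contrapT => nloop; apply: nV.
pose D : fam1 := fun z al x => exists y, Q z al x y.
have aD : adm1 v D.
  apply: (adm_ex (v := v)).
  exact: (adm2_at (i := Some tt) (j := None) (Q := Q)).
have mQ z al x y : Q z id x y -> Q z al x y.
  by have [_ m _] := aQ; exact: (m z al (fun b => if b then y else x)).
exists k, (pbinary_of Q), (punary_of (fun z => D z id)).
split; first exact: k_gt0; last by split; [apply: pbinary_qdef; have [] := aQ|exact: punary_qdef].
split.
- move=> z; have [x [y Qxy]] := Q0 (fun_of z); apply/set0Pn; exists x.
  by rewrite usection_of; apply/asboolP; exists y.
- move=> z; apply/subsetP => p /imsetP [d]; rewrite usection_of => /asboolP [y Qdy] ->.
  rewrite bsection_diag_of; apply/asboolP => c; have [f Sf <-] := Qr _ _ _ Qdy.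
  exact: (adm_sol c aQ Sf).
- move=> z; split; apply/setP => x; rewrite usection_of.
    apply/imsetP/asboolP => [[[a b]]|[y Qxy]].
      by rewrite bsection_all_of => [/asboolP Qab ->|al]; [exists b|exact: mQ].
    by exists (x, y); rewrite ?bsection_all_of => // [|al]; [exact/asboolP|exact: mQ].
  apply/imsetP/asboolP => [[[a b]]|[y Qxy]].
    rewrite bsection_all_of => [/asboolP Qab ->|al]; [exact: Qs Qab|exact: mQ].
  have [t Qtx] := Qp _ _ _ Qxy; exists (t, x) => //.
  by rewrite bsection_all_of => [|al]; [exact/asboolP|exact: mQ].
- have [t tz] := fun_of_surj z0; exists t; apply/setP => -[x y]; rewrite inE in_set0.
  apply/negP => /andP [h /imsetP [d _ [xd yd]]]; apply: nloop; exists d.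
  move: h; rewrite xd yd bsection_all_of => [/asboolP|al]; [by rewrite tz|exact: mQ].
Qed.

Lemma mightyIV_rule : ~ has_mightyIV -> no_mightyIV R Sol v.
Proof.
move=> nIV Q D U C aQ aD aU aC U0 UD C0 CD UQ DQ UQD z0.
apply: contrapT => nmeet; apply: nIV.
have mQ z al x y : Q z id x y -> Q z al x y.
  by have [_ m _] := aQ; exact: (m z al (fun b => if b then y else x)).
(* At constant [al], [Q] may lead out of [D], while condition 3 asks for equality. The restriction
   uses [D] at [id] for every [al], so only definability of [Q'] is claimed. *)
pose Q' : fam2 := fun z al x y => Q z al x y /\ (D z id x /\ D z id y).
have mQ' z al x y : Q' z id x y -> Q' z al x y by move=> [/mQ h ?]; split.
exists k, (pbinary_of Q'), (punary_of (fun z => D z id)),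
  (punary_of (fun z => U z id)), (punary_of (fun z => C z id)).
split; first exact: k_gt0.
  split.
  - move=> z; split.
    + by have [x Ux] := U0 (fun_of z); apply/set0Pn; exists x; rewrite usection_of; apply/asboolP.
    + by apply/subsetP => x; rewrite !usection_of => /asboolP /UD h; apply/asboolP.
    + by have [x Cx] := C0 (fun_of z); apply/set0Pn; exists x; rewrite usection_of; apply/asboolP.
    + by apply/subsetP => x; rewrite !usection_of => /asboolP /CD h; apply/asboolP.
  - move=> z; apply/setP => y; rewrite inE usection_of; apply/existsP/asboolP.
      move=> [x /andP []]; rewrite usection_of bsection_all_of => [|al]; last exact: mQ'.
      by move=> /asboolP Ux /asboolP [Qxy _]; apply/UQ; exists x.
    move=> Uy; have /UQ [x [Ux Qxy]] := Uy; exists x.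
    rewrite usection_of bsection_all_of => [|al]; last exact: mQ'.
    by apply/andP; split; apply/asboolP => //; split=> //; split; exact: UD.
  - move=> z; apply/setP => y; rewrite inE usection_of; apply/existsP/asboolP.
      move=> [x /andP [_]]; rewrite bsection_diag_of => /asboolP /(_ a0).
      by move=> [_ []].
    move=> Dy; have [x Ux Qxy] := UQD _ _ Dy; exists x.
    rewrite usection_of bsection_diag_of; apply/andP; split; apply/asboolP => // c.
    by split; [exact: Qxy|split=> //; exact: UD].
  - move=> z; apply/setP => y; rewrite inE usection_of; apply/existsP/asboolP.
      move=> [x /andP []]; rewrite usection_of bsection_all_of => [|al]; last exact: mQ'.
      by move=> _ /asboolP [_ []].
    move=> Dy; have /DQ [x [Dx Qxy]] := Dy; exists x.
    rewrite usection_of bsection_all_of => [|al]; last exact: mQ'.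
    by apply/andP; split; apply/asboolP.
  - have [t tz] := fun_of_surj z0; exists t; apply/setP => x; rewrite inE in_set0.
    apply/negP; rewrite !usection_of tz => /andP [/asboolP Ux /asboolP Cx].
    by apply: nmeet; exists x.
split; [apply: pbinary_qdef|exact: punary_qdef..].
have [qQ _ _] := aQ.
apply: (qdef_and qQ).
have dD (b : bool) : @par_qdef A _ R bool (fun z _ e => D z id (e b)).
  apply: (par_qdef_id (lab := fun _ => v) (P := fun z al e => D z al (e b))).
  exact: (adm1_at (i := b) (U := D)).
exact: qdef_and (dD false) (dD true).
Qed.

End Rules.

(** * Strategies *)

(** Propagation never removes a value of a self-supporting [P], whether [P] is definable or not. *)
Lemma refine_max (A Var Con : finType) (ar : Con -> nat) (sc : forall c, 'I_(ar c) -> Var)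
    (K : forall c, ('I_(ar c) -> A) -> Prop) (M P : Var -> A -> Prop) s u x :
  (forall c (i : 'I_(ar c)) x, P (sc c i) x ->
     exists b, [/\ K c b, b i = x & forall j, P (sc c j) (b j)]) ->
  (forall u x, P u x -> M u x) -> P u x -> refine sc K M s u x.
Proof.
move=> supP PM; elim: s u x => [|s IH] u x Px /=; first exact: PM.
split=> [|c i /eqP sci]; first exact: IH.
rewrite -sci in Px; have [b [Kb bi Pb]] := supP _ _ _ Px; exists b.
by split=> //; split=> // j; exact: IH.
Qed.

Section Strategies.

Variables (k n : nat) (R : {set (n.+1 + n).-tuple 'I_k}).

Notation A := 'I_k.
Notation Z := {ffun A -> A}.

(* The universal player is restricted to the image of al: al = id is the real
   game, and a constant al leaves the universal player no choice. *)
Fixpoint strategy (al : A -> A) (d : nat) (ys xs : seq A) : Prop :=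
  if d is d'.+1 then
    forall b, exists y, strategy al d' (rcons ys y) (rcons xs (al b))
  else Rholds R (ys ++ xs).

Definition sR (l : nat) (ys xs : seq A) : Prop :=
  if l == n then is_true (Rholds R (ys ++ xs))
  else forall x, exists y1, forall x', exists ys' : seq A, size ys' = n - l.+1 /\
    Rholds R ((ys ++ y1 :: ys') ++ (xs ++ x :: nseq (n - l.+1) x')).

Lemma S_RP m (y : m.+1.-tuple A) (xs : m.-tuple A) :
  reflect (sR m y xs) (S_R R y xs).
Proof.
rewrite /S_R /sR; case: eqP => _; first exact: idP.
apply: (iffP forallP) => [h x|h x].
  have /existsP [y1 /forallP h1] := h x; exists y1 => x'.
  have /existsP [ys Rys] := h1 x'; exists ys; split=> //; exact: size_tuple.
have [y1 h1] := h x; apply/existsP; exists y1; apply/forallP => x'.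
have [ys [sys Rys]] := h1 x'; apply/existsP.
by have /eqP sys' := sys; exists (Tuple sys').
Qed.

Lemma strategy_mono al d ys xs : strategy id d ys xs -> strategy al d ys xs.
Proof.
elim: d ys xs => [|d IH] ys xs //= h b; have [y /IH hy] := h (al b); by exists y.
Qed.

Lemma strategy_const c d ys xs :
  (exists ys', size ys' = d /\ Rholds R ((ys ++ ys') ++ (xs ++ nseq d c))) ->
  strategy (fun=> c) d ys xs.
Proof.
elim: d ys xs => [|d IH] ys xs [ys' [sz Rys]].
  by move: Rys; rewrite (size0nil sz) !cats0.
case: ys' sz Rys => // y ys' [sz] Rys b; exists y; apply: IH; exists ys'.
by rewrite !cat_rcons.
Qed.

Lemma strategy_path c d ys xs : strategy id d ys xs ->
  exists ys', size ys' = d /\ Rholds R ((ys ++ ys') ++ (xs ++ nseq d c)).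
Proof.
elim: d ys xs => [|d IH] ys xs h; first by exists [::]; rewrite !cats0.
have [y /IH [ys' [sz Rys]]] := h c; exists (y :: ys').
by rewrite /= sz; move: Rys; rewrite !cat_rcons.
Qed.

Lemma strategy_sR l ys xs : l <= n -> strategy id (n - l) ys xs -> sR l ys xs.
Proof.
rewrite leq_eqVlt /sR => /predU1P [->|lt]; first by rewrite eqxx subnn.
rewrite ltn_eqF // -{1}(subnSK lt) => h x; have [y h1] := h x; exists y => x'.
have [ys' [sz Rys]] := strategy_path x' h1; exists ys'; split=> //.
by move: Rys; rewrite !cat_rcons.
Qed.

Definition extends (al : A -> A) (d : nat) (ys xs : seq A) (x : A) : Prop :=
  exists y, strategy al d (rcons ys y) (rcons xs x).

(** After the move [x], a constant opponent repeats the single value [c]; this is the instance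
    [x' = c] of [sR]. *)
Lemma sR_extends l ys xs x c : l < n -> sR l ys xs ->
  extends (fun=> c) (n - l.+1) ys xs x.
Proof.
move=> lt; rewrite /sR ltn_eqF // => /(_ x) [y h]; exists y.
have [ys' [sz Rys]] := h c; apply: strategy_const; exists ys'; split=> //.
by rewrite !cat_rcons.
Qed.

Lemma qdef_Rholds (I : finType) (vs : seq I) : size vs = n.+1 + n ->
  qdef R (fun e : I -> A => Rholds R (map e vs)).
Proof.
move=> sv; have /eqP sv' := sv.
apply: qdef_iff (qdef_atom R (tnth (Tuple sv'))) => e.
have vE : val [tuple e (tnth (Tuple sv') i) | i < n.+1 + n] = map e vs.
  rewrite -[map e vs]/(val (map_tuple e (Tuple sv'))); congr val.
  by apply: eq_from_tnth => i; rewrite tnth_mktuple tnth_map.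
split=> [h|/existsP [t /andP [tR /eqP tv]]].
  by apply/existsP; eexists; apply/andP; split; [exact: h|rewrite vE].
by rewrite (_ : [tuple _ | _ < _] = t) //; apply: val_inj; rewrite vE -tv.
Qed.

Lemma qdef_strategy d (I : finType) (vs us : seq I) (af : A -> I) :
  d <= n -> size vs = n.+1 - d -> size us = n - d ->
  qdef R (fun e : I -> A => strategy (fun b => e (af b)) d (map e vs) (map e us)).
Proof.
elim: d I vs us af => [|d IH] I vs us af dn sv su.
  apply: qdef_iff (qdef_Rholds (vs := vs ++ us) _) => [e|]; first by rewrite map_cat.
  by rewrite size_cat sv su !subn0.
(* [b] only names the variable holding the move [al b], so this is a finite conjunction and not a
   universal quantifier. *)
apply: qdef_forall_fin => b.
apply: (qdef_ex (P := fun e y => strategy (fun b => e (af b)) d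
  (rcons (map e vs) y) (rcons (map e us) (e (af b))))).
have h := IH (option I) (rcons (map Some vs) None) (rcons (map Some us) (Some (af b)))
  (fun b => Some (af b)) (ltnW dn).
apply: qdef_iff (h _ _) => [e||]; rewrite ?map_rcons -?map_comp //.
  by rewrite size_rcons size_map sv subnSK // ltnW.
by rewrite size_rcons size_map su subnSK.
Qed.

Lemma qdef_sR l (I : finType) (vs us : seq I) :
  l <= n -> size vs = l.+1 -> size us = l ->
  qdef R (fun e : I -> A => sR l (map e vs) (map e us)).
Proof.
move=> ln sv su; rewrite /sR; case: eqP => [eln|/eqP nl].
  apply: qdef_iff (qdef_Rholds (vs := vs ++ us) _) => [e|]; first by rewrite map_cat.
  by rewrite size_cat sv su eln.
have {nl}lt : l < n by rewrite ltn_neqAle nl.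
pose body (e : I -> A) x y1 x' (b : 'I_(n - l.+1) -> A) := Rholds R
  ((map e vs ++ y1 :: codom b) ++ (map e us ++ x :: nseq (n - l.+1) x')).
suff: qdef R (fun e => forall x, exists y1, forall x', exists b, body e x y1 x' b).
  apply: qdef_iff => e; split=> h x; have [y1 h1] := h x; exists y1 => x'.
    have [b Rb] := h1 x'; exists (codom b); split=> //.
    by rewrite size_codom card_ord.
  have [ys' [sz Rys]] := h1 x'; have /eqP sz' := sz.
  exists (tnth (Tuple sz')); rewrite /body.
  by rewrite (_ : codom _ = ys') // codomE map_tnth_enum.
apply: (qdef_all (P := fun e x => exists y1, forall x', exists b, body e x y1 x' b)).
apply: (qdef_ex (P := fun e y1 => forall x', exists b,
  body (fun i => e (Some i)) (e None) y1 x' b)).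
apply: (qdef_all (P := fun e x' => exists b,
  body (fun i => e (Some (Some i))) (e (Some None)) (e None) x' b)).
apply: (qdef_ex_ord (P := fun e b =>
  body (fun i => e (Some (Some (Some i)))) (e (Some (Some None))) (e (Some None)) (e None) b)).
pose J : finType := (option (option (option I)) + 'I_(n - l.+1))%type.
pose ix : J := inl (Some (Some None)).
pose iy : J := inl (Some None).
pose ix' : J := inl None.
pose ii (i : I) : J := inl (Some (Some (Some i))).
have [en [sen cen]] : exists en : seq 'I_(n - l.+1), size en = n - l.+1 /\
    forall b : 'I_(n - l.+1) -> A, codom b = map b en.
  by exists (enum 'I_(n - l.+1)); rewrite size_enum_ord; split=> // b; rewrite codomE.
have h := @qdef_Rholds J ((map ii vs ++ iy :: map inr en) ++
  (map ii us ++ ix :: nseq (n - l.+1) ix')).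
apply: qdef_iff (h _) => [e|].
  by rewrite /body !map_cat /= map_nseq -!map_comp cen; exact: iff_refl.
rewrite !size_cat /= !size_map size_nseq sen sv su.
by rewrite subnSK // addSn subnKC // ltnW.
Qed.

End Strategies.

(** * Lowering the depth at which full strategies are required *)

Section Levels.

Variables (k n : nat) (R : {set (n.+1 + n).-tuple 'I_k}).
Hypothesis a0 : 'I_k.
Hypothesis nV : ~ has_mightyV R.
Hypothesis nIV : ~ has_mightyIV R.

Notation A := 'I_k.
Notation Z := {ffun A -> A}.
Notation sR := (sR R).
Notation strategy := (strategy R).
Notation extends := (extends R).

Definition level_rel (m : nat) (w b : seq A) : Prop :=
  if size w < m then sR (size w) b w else strategy id (n - m) b w.

(* 1-consistency of the instance for the identity parameters in which the
   constraints of depth m are replaced by full strategies.  The variables are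
   indexed by the words of values chosen by the universal player. *)
Definition level_consistent (m : nat) : Prop := exists D : seq A -> A -> Prop,
  (forall u, size u <= m -> exists x, D u x) /\
  forall w i x, size w <= m -> i <= size w -> D (take i w) x ->
    exists b, [/\ size b = (size w).+1, level_rel m w b, nth x b i = x &
      forall j, j <= size w -> D (take j w) (nth x b j)].

Section Step.

Variable m : nat.
Hypothesis mn : m < n.
Variable D : seq A -> A -> Prop.
Hypothesis D0 : forall u, size u <= m.+1 -> exists x, D u x.
Hypothesis consD : forall w i x, size w <= m.+1 -> i <= size w -> D (take i w) x ->
  exists b, [/\ size b = (size w).+1, level_rel m.+1 w b, nth x b i = x &
    forall j, j <= size w -> D (take j w) (nth x b j)].

Let ar (c : word k m) : nat := (size c).+1.
Let sc (c : word k m) (i : 'I_(ar c)) : word k m := prefix_word i c.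

Definition listing (l : nat) (e : 'I_l -> A) : seq A := map e (enum 'I_l).

Lemma size_listing l (e : 'I_l -> A) : size (listing e) = l.
Proof. by rewrite size_map size_enum_ord. Qed.

Lemma nth_listing l (e : 'I_l -> A) x (j : 'I_l) : nth x (listing e) j = e j.
Proof. by rewrite (nth_map j) ?size_enum_ord // nth_ord_enum. Qed.

Lemma listing_nth l (b : seq A) x : size b = l ->
  listing (fun j : 'I_l => nth x b j) = b.
Proof.
move=> sb; apply: (@eq_from_nth _ x); rewrite size_listing // => i il.
by rewrite (nth_listing _ x (Ordinal il)).
Qed.

Definition deeper_rel (c : word k m) (e : 'I_(ar c) -> A) : Prop :=
  sR (size c) (listing e) c /\
  (size c == m -> forall a, extends id (n - m.+1) (listing e) c a).

Section TreeInstance.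

Variables (s : nat) (u0 : word k m).

Let W : finType := s.-bseq (tstep ar).
Let tl (p : s.-bseq (tstep ar)) : word k m := tlab sc u0 p.
Let node : finType := (W * {c : word k m & 'I_(ar c)})%type.

Definition valid (x : node) : bool :=
  (size (x.1 : s.-bseq (tstep ar)) < s) && (tl x.1 == sc (tagged x.2)).

(* The constraint of a node occurs once as S and once, for every letter a, as
   the projection of the full strategies after the universal move z a. *)
Let Con : finType := (node * option A)%type.
Let arC (x : Con) : nat := ar (tag x.1.2).
Let scC (x : Con) (j : 'I_(arC x)) : W :=
  if j == tagged x.1.2 then x.1.1 else insub_bseq s (tmk (tagged x.1.2) j :: x.1.1).

Let shallow (z : Z) (c : word k m) (e : 'I_(ar c) -> A) : Prop :=
  sR (size c) (listing e) (map z c).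

Let SolC (z : Z) (f : W -> A) : Prop := tree_sat sc u0 (shallow z) f.

Let C (x : Con) (z : Z) (al : A -> A) (e : 'I_(arC x) -> A) : Prop :=
  valid x.1 ->
  if x.2 is Some a then
    size (tag x.1.2) == m ->
    extends al (n - m.+1) (listing e) (map z (tag x.1.2)) (z a)
  else shallow z e.

Lemma par_listing (I : finType) (l : nat) (g : 'I_l -> I) (e : A + (A + I) -> A) :
  listing (fun i => e (inr (inr (g i)))) = map e (map (fun i => inr (inr (g i))) (enum 'I_l)).
Proof. by rewrite -map_comp. Qed.

Lemma par_word (I : finType) (c : seq A) (e : A + (A + I) -> A) :
  map [ffun a => e (inl a)] c = map e (map inl c).
Proof. by rewrite -map_comp; apply: eq_map => a; rewrite ffunE. Qed.

Lemma par_qdef_shallow (I : finType) (c : word k m) (g : 'I_(ar c) -> I) :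
  par_qdef R (fun z al (e : I -> A) => shallow z (fun i => e (g i))).
Proof.
have sc' : size c <= n by apply: leq_trans (size_bseq c) (ltnW mn).
pose vs := map (fun i => inr (inr (g i)) : A + (A + I)) (enum 'I_(ar c)).
pose us := map (fun a => inl a : A + (A + I)) c.
have h := qdef_sR R (vs := vs) (us := us) sc'.
apply: qdef_iff (h _ _) => [e||].
- by rewrite /shallow par_listing par_word; exact: iff_refl.
- by rewrite /vs size_map size_enum_ord.
- by rewrite /us size_map.
Qed.

(** Strategies survive a restriction of the opponent, and against a constant opponent they exist
    along every solution of the shallow constraints by [sR_extends]. *)
Lemma adm_constraint (x : Con) : adm R SolC (@scC x) (@C x).
Proof.
case: x => -[p [c i]] o; apply: adm_imp => /= vx; case: o => [a|] /=; last first.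
  split=> [|//|z f _ Sf].
  - exact: (par_qdef_shallow id).
  - exact: Sf vx.
apply: adm_imp => /eqP cm; split=> [|z al e [y h]|z f c1 Sf].
- pose J : finType := option (A + (A + 'I_(ar c))).
  pose vs : seq J := rcons (map (fun i => Some (inr (inr i))) (enum 'I_(ar c))) None.
  pose us : seq J := rcons (map (fun b => Some (inl b)) c) (Some (inl a)).
  apply: (qdef_ex (P := fun e y => strategy (fun b => e (inr (inl b))) (n - m.+1)
    (rcons (listing (fun i : 'I_(ar c) => e (inr (inr i)))) y)
    (rcons (map [ffun b => e (inl b)] c) ([ffun b => e (inl b)] a)))).
  have h := @qdef_strategy _ _ R (n - m.+1) J vs us (fun b => Some (inr (inl b))).
  apply: qdef_iff (h _ _ _) => [e|||].
  + rewrite !map_rcons -[map e (map _ (enum _))]map_comp -[map e (map _ c)]map_comp ffunE /listing.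
    rewrite (_ : map [ffun b => e (Some (inl b))] c = map (e \o (fun b => Some (inl b))) c).
      exact: iff_refl.
    by apply: eq_map => b; rewrite ffunE.
  + exact: leq_subr.
  + by rewrite /vs size_rcons size_map size_enum_ord /ar cm subSn ?leq_subr // subKn.
  + by rewrite /us size_rcons size_map cm subKn.
- by exists y; exact: strategy_mono.
- have -> : n - m.+1 = n - (size c).+1 by rewrite cm.
  apply: sR_extends; first by rewrite cm.
  exact: Sf vx.
Qed.

Lemma adm_reachedC w : adm1 R SolC w (fun z _ x => reached SolC w z x).
Proof.
have aS : adm R SolC (fun w : W => w) (fun z _ f => SolC z f).
  split=> //; apply: qdef_forall_fin => p; apply: qdef_forall_fin => c.
  apply: qdef_forall_fin => i.
  case: (boolP ((size p < s) && (tlab sc u0 p == sc i))) => [h|nh].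
    apply: qdef_iff (par_qdef_shallow (fun j =>
      if j == i then p else insub_bseq s (tmk i j :: p))) => e.
    by split=> // h'; exact: h'.
  by apply: qdef_iff (qdef_true R _) => e; split=> // _; rewrite (negbTE nh).
apply: adm_iff (adm_pr1 w aS) => z al e.
by split=> [[f [Sf fw]]|[f Sf fw]]; exists f.
Qed.

(** Parameters act by renaming words: the constraint of [c] for parameters [z] is that of [map z c]
    for identity parameters. So the domains [D] serve all [z] at once. *)
Let P (z : Z) (p : W) (x : A) : Prop := D (map z (tl p)) x.

Lemma supp_shallow (z : Z) c (i : 'I_(ar c)) x : D (map z (sc i)) x ->
  exists b, [/\ shallow z b, b i = x & forall j, D (map z (sc j)) (b j)].
Proof.
move=> Dx; have cm : size (map z c) <= m by rewrite size_map; exact: size_bseq.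
have ic : i <= size (map z c) by rewrite size_map -ltnS.
have Dx' : D (take i (map z c)) x by rewrite -map_take.
have [b [sb Kb bi Db]] := consD (leqW cm) ic Dx'; rewrite size_map in sb.
exists (fun j => nth x b j); split=> //.
  rewrite /shallow (listing_nth x sb).
  by move: Kb; rewrite /level_rel ltnS cm size_map.
by move=> j; rewrite /= map_take; apply: Db; rewrite size_map -ltnS.
Qed.

Lemma supp_full (z : Z) c (i : 'I_(ar c)) x a : size c = m -> D (map z (sc i)) x ->
  exists b, [/\ extends id (n - m.+1) (listing b) (map z c) (z a), b i = x &
    forall j : 'I_(ar c), D (map z (sc j)) (b j)].
Proof.
move=> cm Dx; pose w := map z (rcons c a).
have sw : size w = m.+1 by rewrite size_map size_rcons cm.
have tw (j : 'I_(ar c)) : take j w = map z (sc j).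
  have jc : j <= size c by rewrite -ltnS.
  by rewrite /w -map_take -cats1 takel_cat.
have le (j : 'I_(ar c)) : j <= size w by rewrite sw -cm ltnW // ltn_ord.
have [||b [sb Kb bi Db]] := @consD w i x _ (le i).
- by rewrite sw.
- by rewrite tw.
exists (fun j => nth x b j); split=> //; last by move=> j; rewrite -tw; exact: Db.
exists (nth x b m.+1); move: Kb; rewrite /level_rel sw ltnn.
rewrite /w map_rcons; congr (strategy _ _ _ _).
apply: (@eq_from_nth _ x); first by rewrite size_rcons size_listing sb sw /ar cm.
move=> j; rewrite sb sw ltnS leq_eqVlt nth_rcons size_listing /ar cm.
case/predU1P => [->|jm]; first by rewrite ltnn eqxx.
by rewrite jm (nth_listing _ x (Ordinal jm)).
Qed.

Lemma tl_scC (x : Con) (j : 'I_(arC x)) : valid x.1 -> tl (scC j) = sc j.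
Proof.
move=> /andP [lt /eqP e]; rewrite /scC; case: eqP => [->|_]; first exact: e.
by rewrite /tl /insub_bseq insubdK.
Qed.

Lemma P_scC (x : Con) (j : 'I_(arC x)) (z : Z) y :
  valid x.1 -> D (map z (sc j)) y -> P z (scC j) y.
Proof. by move=> vx; rewrite /P tl_scC. Qed.

Lemma supp_constraints (z : Z) : supports scC C (P z) z.
Proof.
move=> x j y; case: (boolP (valid x.1)) => [vx|nvx]; last first.
  move=> Py; have h (i : 'I_(arC x)) : exists t, P z (scC i) t.
    by apply: D0; rewrite size_map; apply: leqW; exact: size_bseq.
  have /choice [b Pb] := h; exists (fun i => if i == j then y else b i).
  rewrite eqxx; split=> //; first by rewrite /C (negbTE nvx).
  by move=> i; case: eqP => [->|].
rewrite /P tl_scC // => Dy; case: x vx j Dy => -[p [c i]] o vx j Dy.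
have fin b : (forall j', D (map z (@sc c j')) (b j')) ->
    forall j', P z (@scC (p, existT _ c i, o) j') (b j').
  by move=> Db j'; exact: P_scC vx (Db j').
case: o vx j Dy fin => [a|] vx j Dy fin; last first.
  have [b [Kb bj /fin Db]] := supp_shallow Dy; exists b.
  by split; [move=> _; exact: Kb|exact: bj|exact: Db].
have [cm|ncm] := boolP (size c == m).
  have [b [Kb bj /fin Db]] := supp_full a (eqP cm) Dy.
  by exists b; split; [move=> _ _; exact: Kb|exact: bj|exact: Db].
have [b [_ bj /fin Db]] := supp_shallow Dy; exists b; split=> // _ /= cm.
by rewrite cm in ncm.
Qed.

Lemma P_reached z p x : P z p x -> reached SolC p z x.
Proof.
move=> Px.
have [|||a [Ta _ ap]] := @tree_extends A _ _ ar sc s u0 (shallow z)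
    (fun u => D (map z u)) _ _ p x => //.
- by move=> u; apply: D0; rewrite size_map; apply: leqW; exact: size_bseq.
- by move=> c i y; exact: supp_shallow.
by exists a.
Qed.

(** The tree is an instance whose constraints are [shallow] and [extends]; [consistent_solvable] is
    applied to it and read at the identity parameters. *)
Lemma tree_solution : exists a : W -> A, tree_sat sc u0 deeper_rel a.
Proof.
have [t st] := @refine_stable A _ _ arC scC C (fun w z _ x => reached SolC w z x).
have consistentC : exists D', consistent R SolC scC C D'.
  (* [P] itself need not be definable. Propagation from the reached values is, and it keeps [P],
     hence stays nonempty. *)
  exists (fun u z al => refine scC (fun c => @C c z al)
    (fun w => reached SolC w z) t u); split.
  - move=> u; apply: adm_refine; [exact: adm_constraint|exact: adm_reachedC].
  - move=> u z; have [|x Px] := @D0 (map z (tl u)).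
      by rewrite size_map; apply: leqW; exact: size_bseq.
    exists x; apply: (refine_max (P := P z)) => //.
      by move=> c i y; exact: supp_constraints.
    by move=> w y; exact: P_reached.
  - by move=> u z x /refine_sub.
  - by move=> z; apply: (refine_consistent (M := fun w z _ x => reached SolC w z x)) =>
      u x; exact: st.
have [//|||g Hg] := consistent_solvable _ adm_constraint adm_reachedC _ _ consistentC [ffun a => a].
- by move=> v; exact: mightyV_rule.
- by move=> v; exact: mightyIV_rule.
have mid (c : seq A) : map [ffun a => a] c = c.
  by rewrite -[RHS]map_id; apply: eq_map => a; rewrite ffunE.
exists g => p c i vx; pose q : node := (p, Tagged (fun c => 'I_(ar c)) i).
split.
  by have := Hg (q, None) vx; rewrite /= /shallow mid.
move=> cm a; have := Hg (q, Some a) vx cm.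
by rewrite /= mid ffunE.
Qed.

End TreeInstance.

(** Propagation with [deeper_rel] from the full domain stabilizes after [s] rounds. A solution of
    the tree with [s] levels rooted at [u] leaves a value in the domain of [u]. *)
Lemma level_step : level_consistent m.
Proof.
pose K (c : word k m) : Z -> (A -> A) -> ('I_(ar c) -> A) -> Prop :=
  fun _ _ => @deeper_rel c.
have [s st] := @refine_stable A _ _ ar sc K (fun _ _ _ _ => True).
pose z1 : Z := [ffun a => a].
pose Rf := refine sc deeper_rel (fun _ _ => True) s.
have inhR u : exists x, Rf u x.
  have [a Ta] := tree_solution s u.
  exists (a [bseq]); exact: (@tree_refine A _ _ ar sc s u deeper_rel (fun _ _ => True) a s [bseq]).
have take_word (c : word k m) i : insub_bseq m (take i c) = prefix_word i c.
  by apply: val_inj; rewrite /insub_bseq insubdK //; exact: size_take_word.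
exists (fun w => Rf (insub_bseq m w)); split=> [u _|w i x wm iw]; first exact: inhR.
have [c cw] : exists c : word k m, w = c by exists (Bseq wm).
rewrite cw in iw *; rewrite take_word => Rx.
have iw' : i < ar c by [].
have [_ /(_ c (Ordinal iw') (eqxx _)) [b [[[Sb Gb] Rb] bi]]] := st z1 _ _ Rx.
exists (listing b); split.
- exact: size_listing.
(* At depth [m], the answers to all letters [a] together form a full strategy with one more move. *)
- rewrite /level_rel; case: ltnP => // mc.
  have cm : size c = m by apply/eqP; rewrite eqn_leq mc size_bseq.
  by rewrite -(subnSK mn) => y; apply: Gb; rewrite cm.
- by rewrite (nth_listing b x (Ordinal iw')).
- move=> j jc; have jc' : j < ar c by [].
  by rewrite take_word (nth_listing b x (Ordinal jc')); exact: (Rb (Ordinal jc')).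
Qed.

End Step.

End Levels.

(** * From the instance to strategies and back *)

Section Translation.

Variables (k n : nat) (R : {set (n.+1 + n).-tuple 'I_k}).

Notation A := 'I_k.

(** At the identity parameters a word is itself the list of universal moves, and at depth [n] a
    strategy with no moves left is [R]. *)
Lemma level_top (D : word k n -> punary k) :
  nonempty_reduction D -> one_consistent_reduction R D -> level_consistent R n.
Proof.
move=> D0 consD; pose z : k.-tuple A := [tuple a | a < k].
have zid : tnth z =1 id by move=> a; rewrite tnth_mktuple.
exists (fun w x => x \in usection (D (insub_bseq n w)) z); split=> [u _|w i x wn iw Dx].
  by have /set0Pn [x Dx] := D0 (insub_bseq n u) z; exists x.
have take_word (c : word k n) j : insub_bseq n (take j c) = prefix_word j c.
  by apply: val_inj; rewrite /insub_bseq insubdK //; exact: size_take_word.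
have [c cw] : exists c : word k n, w = c by exists (Bseq wn).
rewrite {w wn}cw in iw Dx *; have iw' : i < (size c).+1 by [].
have Dx' : x \in usection (D (tnth (scope (I_R R z c)) (Ordinal iw'))) z.
  by rewrite tnth_mktuple /= -take_word.
have := consD z c (Ordinal iw'); move/setP/(_ x); rewrite Dx'.
move=> /imsetP [t /setIP [Rt /[!inE] /forallP Dt] xt]; exists t; split.
- exact: size_tuple.
- move: Rt; rewrite inE => /S_RP.
  have -> : val [tuple of map (tnth z) (in_tuple c)] = c.
    by rewrite /= (eq_map zid) map_id.
  rewrite /level_rel; case: ltnP => // nc; have cn : size c = n.
    by apply/eqP; rewrite eqn_leq nc size_bseq.
  by rewrite /sR subnn; case: eqP => // /(_ cn).
- by rewrite [RHS]xt (tnth_nth x).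
- move=> j jc; have jc' : j < (size c).+1 by [].
  have := Dt (Ordinal jc'); rewrite tnth_mktuple /= -take_word.
  by rewrite (tnth_nth x).
Qed.

(** The variable indexed by a word takes the last answer of one fixed strategy to the moves [z_a].
    Constraints hold because prefixes of a word are answered by prefixes of the play. *)
Lemma strategy_solution y0 : strategy R id n [:: y0] [::] ->
  forall z : k.-tuple A, exists s : word k n -> A, is_solution (I_R R z) s.
Proof.
move=> win z.
have /choice [next Hnext] : forall q : (seq A * seq A) * A, exists y,
    forall d, strategy R id d.+1 q.1.1 q.1.2 ->
      d = n - (size q.1.2).+1 -> strategy R id d (rcons q.1.1 y) (rcons q.1.2 q.2).
  move=> [[ys xs] x] /=.
  case: (lem (strategy R id (n - (size xs).+1).+1 ys xs)) => [|nw].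
    by move=> /(_ x) [y Hy]; exists y => d _ ->.
  by exists y0 => d w e; case: nw; rewrite -e.
(* Words are read with the latest move first; the answers are listed in order of play. *)
pose play := fix play (w : seq A) : seq A :=
  if w is x :: w' then rcons (play w') (next ((play w', rev w'), x)) else [:: y0].
have size_play w : size (play w) = (size w).+1.
  by elim: w => [|x w IH] //=; rewrite size_rcons IH.
have play_win w : size w <= n -> strategy R id (n - size w) (play w) (rev w).
  elim: w => [|x w IH] /= ltn; first by rewrite subn0.
  rewrite rev_cons; apply: (Hnext ((play w, rev w), x)); last by rewrite size_rev.
  by rewrite subnSK //; exact: IH (ltnW ltn).
pose s (u : word k n) : A := last y0 (play (rev (map (tnth z) u))).
have play_take w j : j <= size w ->
    nth y0 (play (rev w)) j = last y0 (play (rev (take j w))).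
  elim/last_ind: w j => [|w x IH] j; first by rewrite leqn0 => /eqP ->.
  rewrite size_rcons leq_eqVlt => /predU1P [->|jw].
    rewrite take_oversize ?size_rcons // -nth_last size_play size_rev size_rcons.
    by [].
  have -> : take j (rcons w x) = take j w by rewrite -cats1 takel_cat.
  by rewrite rev_rcons /= nth_rcons size_play size_rev jw IH.
exists s => c; rewrite inE; apply/S_RP.
have cn : size c <= n by exact: size_bseq.
pose w := map (tnth z) c.
have wc : size w = size c by rewrite size_map.
have -> : val [tuple of map (tnth z) (in_tuple c)] = w by [].
have playE (t : (size c).+1.-tuple A) :
    (forall j, tnth t j = s (prefix_word j c)) -> val t = play (rev w).
  move=> tE; apply: (@eq_from_nth _ y0) => [|j].
    by rewrite size_play size_rev wc size_tuple.
  rewrite size_tuple => jc; rewrite (play_take w j); last by rewrite wc.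
  by rewrite -(tnth_nth y0 t (Ordinal jc)) tE /s /= map_take.
rewrite (playE [tuple of map s (scope (I_R R z c))]); last first.
  by move=> j; rewrite tnth_map tnth_mktuple.
apply: strategy_sR; first exact: cn.
by have := play_win (rev w); rewrite size_rev revK wc; exact.
Qed.

End Translation.

Theorem theorem22 (k n : nat) (hn : 1 <= n)
    (R : {set (n.+1 + n).-tuple 'I_k})
    (hred : exists D : word k n -> punary k,
        nonempty_reduction D /\ one_consistent_reduction R D) :
  (forall z : k.-tuple 'I_k,
      exists s : word k n -> 'I_k, is_solution (I_R R z) s)
  \/
  ((exists (m : nat) (Q : pbinary k m) (D B C : punary k),
      [/\ 1 <= m, mightyIV Q D B C
        & [/\ qdefinable R Q, qdefinable R D, qdefinable R B & qdefinable R C]])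
   \/
   (exists (m : nat) (Q : pbinary k m) (D : punary k),
      [/\ 1 <= m, mightyV Q D & qdefinable R Q /\ qdefinable R D])).
Proof.
have [D [D0 consD]] := hred.
have [nIV|yIV] := lem (~ has_mightyIV R); last by right; left; exact: contrapT.
have [nV|yV] := lem (~ has_mightyV R); last by right; right; exact: contrapT.
(* For [k = 0] the empty tuple [z] exists and the nonempty domain at it would contain an element of
   an empty type. *)
left; have a0 : 'I_k.
  case: (k) D D0 {R hred consD nIV nV} => [|k'] D D0; last exact: ord0.
  have /set0Pn h := D0 [bseq] [tuple]; exact: (projT1 (cid h)).
have level d : d <= n -> level_consistent R (n - d).
  elim: d => [|d IH] dn; first by rewrite subn0; exact: level_top consD.
  have mn : n - d.+1 < n by rewrite ltn_subrL /= (leq_trans _ dn).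
  have [E [E0 consE]] := IH (ltnW dn).
  by apply: (level_step a0 nV nIV mn (D := E)); rewrite subnSK.
have [E [E0 consE]] := level n (leqnn n); rewrite subnn in E0 consE.
have [x Ex] := E0 [::] isT.
have [b [sb Kb _ _]] := consE [::] 0 x isT isT Ex.
(* At level 0 the constraint of the empty word is a full strategy of [n] moves from a single value
   [y0]. *)
case: b sb Kb => [|y0 [|]] // _; rewrite /level_rel subn0 => win.
exact: strategy_solution win.
Qed.
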